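(* Let $\mathbb{K}$ be a field in which arithmetic operations are done in constant time. Let $A=\sum_{k=1}^m A_kx_kt^{c_k}$ with $A_k\in\mathbb{K}^{n\times n}$ and $c_k$ positive integers, let $C:=\max_k c_k$, and suppose $\deg\operatorname{Det}A>-\infty$. Then the algorithm Deg-Det with Cost-Scaling (including the Truncation step) computes $\deg\operatorname{Det}A$ in $$O\bigl((\gamma(n,m)+n^{2+\omega}m^2)\,n^2m\log_2 C\bigr)$$ time, where $\gamma(n,m)$ denotes the time complexity of solving problem (R), and $\omega$ denotes the exponent of the time complexity of matrix multiplication.
   Context: Notation. $x_1,\ldots,x_m$ are noncommutative variables and $t$ is a variable commuting with them. The degree of a rational function $p/q\in\mathbb{K}(t)$ is $\deg p-\deg q$, with $\deg 0=-\infty$. $\deg\operatorname{Det}A$ (degree in $t$ of the Dieudonné determinant) is by definition the optimal value ($-\infty$ if unbounded below) of: minimize $-\deg\det P-\deg\det Q$ over $P,Q\in GL_n(\mathbb{K}(t))$ subject to $\deg(PA_kQ)_{ij}+c_k\le 0$ for all $i,j\in[n]$, $k\in[m]$. For $\alpha\in\mathbb{Z}^n$, $(t^\alpha)$ is the diagonal matrix with diagonal entries $t^{\alpha_1},\ldots,t^{\alpha_n}$; $\mathbf{1}_s\in\mathbb{Z}^n$ has first $s$ entries $1$ and the others $0$. For a matrix $M$ over $\mathbb{K}(t)$ written as a formal series $M=\sum_{\ell\le d}M^{(\ell)}t^{\ell}$, $M^{(\ell)}$ is its coefficient matrix over $\mathbb{K}$ at $t^\ell$ (applied coefficientwise in the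 $x_k$). Problem (R) for a matrix $B=\sum_k B_kx_k$ with $B_k\in\mathbb{K}^{n\times n}$: minimize $2n-r-s$ over $S,T\in GL_n(\mathbb{K})$ such that $SBT$ has an $r\times s$ zero submatrix; it may be assumed that the zero submatrix is in the upper right corner. ''Solving (R)'' means finding an optimal solution $S,T$ (with $r,s$). Algorithm Deg-Det with Cost-Scaling. Step 0: $C\leftarrow\max_k c_k$, $N\leftarrow\lceil\log_2C\rceil$, $\theta\leftarrow0$, $B_k\leftarrow A_k$ for $k\in[m]$, $D^*\leftarrow n$. Step 1: Let $B\leftarrow\sum_kB_kx_k$; solve (R) for $B^{(0)}$ and obtain an optimal solution $S,T$ with $r,s$. Truncation (performed after Step 1): for each $k\in[m]$, remove from $B_k$ all terms $B_k^{(-\ell)}t^{-\ell}$ with $\ell\ge 2n^2m$. Step 2: If the optimal value $2n-r-s$ is less than $n$, let $B_k\leftarrow(t^{\mathbf{1}_r})SB_kT(t^{-\mathbf{1}_{n-s}})$ for all $k$ and $D^*\leftarrow D^*+n-r-s$, and go to Step 1. Step 3: If the optimal value $2n-r-s$ equals $n$: if $\theta=N$, output $D^*$. Otherwise let $B_k\leftarrow B_k(t^2)$ if $\lceil c_k/2^{N-\theta-1}\rceil=2\lceil c_k/2^{N-\theta}\rceil$, and $B_k\leftarrow t^{-1}B_k(t^2)$ if $\lceil c_k/2^{N-\theta-1}\rceil=2\lceil c_k/2^{N-\theta}\rceil-1$; let $D^*\leftarrow 2D^*$, $\theta\leftarrow\theta+1$, and go to Step 1. *)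

(* Defs.v *)
From mathcomp Require Import all_boot all_order all_algebra.
From mathcomp Require Import generic_quotient.
From mathcomp Require Import boolp classical_sets reals constructive_ereal.
From mathcomp Require Import ereal exp.

Set Implicit Arguments.
Unset Strict Implicit.
Unset Printing Implicit Defensive.

Import Order.TTheory GRing.Theory Num.Theory.
Local Open Scope ring_scope.

(* K(t) is {fraction {poly K}}.  The value does not depend on which           *)
(* representative p / q of x is used; size is the degree plus one, and the    *)
(* two shifts cancel in the difference.                                       *)
Definition rdeg (R : realType) (K : fieldType) (x : {fraction {poly K}}) :
    \bar R :=
  if x == 0 then -oo%E
  else ((size \n_(repr x))%:R - (size \d_(repr x))%:R)%:E.

Definition rconst (K : fieldType) (a : K) : {fraction {poly K}} :=
  FracField.tofrac (a%:P).

(* The matrix sum_k A_k x_k t^(c_k) is given by the families A and c.         *)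
Definition degDet_feasible (R : realType) (K : fieldType) (n m : nat)
    (A : 'I_m -> 'M[K]_n) (c : 'I_m -> nat)
    (P Q : 'M[{fraction {poly K}}]_n) : Prop :=
  [/\ P \in unitmx, Q \in unitmx &
      forall (k : 'I_m) (i j : 'I_n),
        (rdeg R ((P *m map_mx (@rconst K) (A k) *m Q) i j) + (c k)%:R%:E
           <= 0)%E].

Definition degDet (R : realType) (K : fieldType) (n m : nat)
    (A : 'I_m -> 'M[K]_n) (c : 'I_m -> nat) : \bar R :=
  ereal_inf [set v : \bar R | exists P Q : 'M[{fraction {poly K}}]_n,
    degDet_feasible R A c P Q /\
    v = (- rdeg R (\det P) - rdeg R (\det Q))%E]%classic.

(* An entry of S (sum_k B_k x_k) T is a linear form in the x_k; it vanishes   *)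
(* when all its coefficients do.                                              *)
Definition zero_block (K : fieldType) (n m : nat) (B : 'I_m -> 'M[K]_n)
    (S T : 'M[K]_n) (I J : {set 'I_n}) : Prop :=
  forall (k : 'I_m) (i j : 'I_n),
    i \in I -> j \in J -> (S *m B k *m T) i j = 0.

Record R_answer (V : Type) (n : nat) := RAnswer {
  R_left : 'M[V]_n; R_right : 'M[V]_n; R_rows : nat; R_cols : nat }.

Definition R_optimal (K : fieldType) (n m : nat) (B : 'I_m -> 'M[K]_n)
    (a : R_answer K n) : Prop :=
  let: RAnswer S_ T_ r s := a in
  [/\ S_ \in unitmx /\ T_ \in unitmx,
      (r <= n)%N /\ (s <= n)%N,
      zero_block B S_ T_ [set i : 'I_n | (i < r)%N]
                       [set j : 'I_n | (n - s <= j)%N] &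
      forall (S' T' : 'M[K]_n) (I J : {set 'I_n}),
        S' \in unitmx -> T' \in unitmx -> zero_block B S' T' I J ->
        (2 * n - r - s <= 2 * n - #|I| - #|J|)%N].

(* V is the type of field elements as seen by programs.  The programs below   *)
(* are written for an arbitrary type V, so that the instructions are their    *)
(* only access to the arithmetic of the field.  Move is the copy of one       *)
(* field element into an array cell.                                          *)
Inductive instr (V : Type) : Type -> Type :=
| FZero : instr V V
| FOne : instr V V
| FAdd of V & V : instr V V
| FSub of V & V : instr V V
| FMul of V & V : instr V V
| FDiv of V & V : instr V V
| FEq of V & V : instr V bool
| Move of V : instr V V
| ZAdd of int & int : instr V int
| ZSub of int & int : instr V int
| ZMul of int & int : instr V int
| ZDiv of int & int : instr V int
| ZEq of int & int : instr V bool
| ZLe of int & int : instr V bool.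

Arguments FZero {V}.
Arguments FOne {V}.
Arguments ZAdd {V} _ _.
Arguments ZSub {V} _ _.
Arguments ZMul {V} _ _.
Arguments ZDiv {V} _ _.
Arguments ZEq {V} _ _.
Arguments ZLe {V} _ _.

(* Loop body s runs body s, restarts from s' if the result is inl s', and     *)
(* stops with value a if the result is inr a.                                 *)
Inductive prog (V : Type) : Type -> Type :=
| Ret A of A : prog V A
| Do A of instr V A : prog V A
| Bind A B of prog V A & (A -> prog V B) : prog V B
| Loop S A of (S -> prog V (S + A)) & S : prog V A.

Arguments Ret {V A} _.

Declare Scope prog_scope.
Delimit Scope prog_scope with prog.
Bind Scope prog_scope with prog.
Notation "x <- p ;; q" := (Bind p (fun x => q))
  (at level 61, p at next level, right associativity) : prog_scope.
Local Open Scope prog_scope.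

Definition instr_sem (K : fieldType) (A : Type) (o : instr K A) : A :=
  match o in instr _ A0 return A0 with
  | FZero => 0
  | FOne => 1
  | FAdd a b => a + b
  | FSub a b => a - b
  | FMul a b => a * b
  | FDiv a b => a / b
  | FEq a b => a == b
  | Move a => a
  | ZAdd x y => x + y
  | ZSub x y => x - y
  | ZMul x y => x * y
  | ZDiv x y => (x %/ y)%Z
  | ZEq x y => x == y
  | ZLe x y => x <= y
  end.

(* exec p a t : the program p terminates with value a after t instructions.   *)
Inductive exec (K : fieldType) : forall A : Type, prog K A -> A -> nat -> Prop :=
| exec_ret A (a : A) : exec (Ret a) a 0
| exec_do A (o : instr K A) : exec (Do o) (instr_sem o) 1
| exec_bind A B (p : prog K A) (f : A -> prog K B) a b t u :
    exec p a t -> exec (f a) b u -> exec (Bind p f) b (t + u)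
| exec_stop S A (body : S -> prog K (S + A)) s a t :
    exec (body s) (inr a) t -> exec (Loop body s) a t
| exec_next S A (body : S -> prog K (S + A)) s s' a t u :
    exec (body s) (inl s') t -> exec (Loop body s') a u ->
    exec (Loop body s) a (t + u).

Fixpoint mapM (V X A : Type) (f : X -> prog V A) (s : seq X) :
    prog V (seq A) :=
  if s is x :: s' then
    (a <- f x ;; r <- mapM f s' ;; Ret (a :: r))
  else Ret [::].

Fixpoint foldM (V X A : Type) (f : X -> A -> prog V A) (s : seq X) (a : A) :
    prog V A :=
  if s is x :: s' then (a' <- f x a ;; foldM f s' a') else Ret a.

Fixpoint tupleM (V A : Type) (n : nat) : ('I_n -> prog V A) ->
    prog V (n.-tuple A) :=
  match n with
  | 0 => fun _ => Ret [tuple]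
  | n'.+1 => fun f =>
      (a <- f ord0 ;; r <- tupleM (fun i : 'I_n' => f (lift ord0 i)) ;;
       Ret [tuple of a :: r])
  end.

Definition matrixM (V : Type) (n : nat) (f : 'I_n -> 'I_n -> prog V V) :
    prog V 'M[V]_n :=
  (rows <- tupleM (fun i => tupleM (f i)) ;;
   Ret (\matrix_(i, j) tnth (tnth rows i) j)).

Definition copy_mx (V : Type) (n : nat) (M : 'M[V]_n) : prog V 'M[V]_n :=
  matrixM (fun i j => Do (Move (M i j))).

Definition zero_mx (V : Type) (n : nat) : prog V 'M[V]_n :=
  matrixM (fun _ _ => Do FZero).

(* Arithmetic circuits.  The memory first holds the entries of the two        *)
(* matrices, in row-major order, and every gate appends one value to it.      *)
Inductive gate (V : Type) :=
| GConst of V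
| GAdd of nat & nat
| GSub of nat & nat
| GMul of nat & nat
| GDiv of nat & nat.

Record circuit (V : Type) (n : nat) := Circuit {
  gates : seq (gate V); outputs : 'I_n -> 'I_n -> nat }.

Definition run_gate (V : Type) (z : V) (mem : seq V) (g : gate V) : prog V V :=
  match g with
  | GConst a => Do (Move a)
  | GAdd i j => Do (FAdd (nth z mem i) (nth z mem j))
  | GSub i j => Do (FSub (nth z mem i) (nth z mem j))
  | GMul i j => Do (FMul (nth z mem i) (nth z mem j))
  | GDiv i j => Do (FDiv (nth z mem i) (nth z mem j))
  end.

Definition multiply (V : Type) (n : nat) (mm : circuit V n) (A B : 'M[V]_n) :
    prog V 'M[V]_n :=
  (z <- Do FZero ;;
   input <- mapM (fun a => Do (Move a))
     ([seq A i j | i <- enum 'I_n, j <- enum 'I_n] ++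
      [seq B i j | i <- enum 'I_n, j <- enum 'I_n]) ;;
   mem <- foldM (fun g mem => (v <- run_gate z mem g ;; Ret (rcons mem v)))
                (gates mm) input ;;
   matrixM (fun i j => Do (Move (nth z mem (outputs mm i j))))).

(* The circuits mm multiply n x n matrices in O(n ^ omega) time.              *)
Definition mm_exponent (R : realType) (K : fieldType)
    (mm : forall n, circuit K n) (omega : R) : Prop :=
  exists kappa : R, forall n : nat, (0 < n)%N -> forall A B : 'M[K]_n,
    exists2 t : nat, exec (multiply (mm n) A B) (A *m B) t &
                     t%:R <= kappa * (n%:R `^ omega).

Definition R_solver (V : Type) :=
  forall n m : nat, ('I_m -> 'M[V]_n) -> prog V (R_answer V n).

Definition solves_R_within (K : fieldType) (solver : R_solver K)
    (gamma : nat -> nat -> nat) : Prop :=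
  forall (n m : nat) (B : 'I_m -> 'M[K]_n),
    exists (a : R_answer K n) (t : nat),
      [/\ exec (solver n m B) a t, R_optimal B a & (t <= gamma n m)%N].

(* The list M_0, M_1, ... represents sum_l M_l t^(-l): the matrices B_k never *)
(* have a term of positive degree.                                            *)
Definition series (V : Type) (n : nat) := seq 'M[V]_n.

(* scale is 2 ^ (N - theta).                                                  *)
Record state (V : Type) (n m : nat) := State {
  theta : int; scale : int; dstar : int; coefs : m.-tuple (series V n) }.

Definition truncate (V : Type) (n : nat) (L : nat) (M : series V n) :
    prog V (series V n) :=
  mapM (@copy_mx V n) (take L M).

(* M |-> t^(1_r) M t^(- 1_(n - s)).  The entry (i, j) is multiplied by        *)
(* t^(a - b) with a = (i < r) and b = (j < n - s), so its new coefficient at  *)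
(* t^(-l) is the old one at t^(-(l + a - b)).  When the upper right r x s     *)
(* block of M_0 is zero, no term of degree 1 arises.                          *)
Definition shift (V : Type) (n : nat) (r s : nat) (M : series V n) :
    prog V (series V n) :=
  (z <- Do FZero ;;
   mapM (fun l => matrixM (fun i j : 'I_n =>
           let a : nat := (i < r)%N in
           let b : nat := (j < n - s)%N in
           Do (Move (if (l + a < b)%N then z
                     else nth (const_mx z) M (l + a - b) i j))))
        (iota 0 (size M).+1)).

Definition mul_lr (V : Type) (n : nat) (mm : circuit V n) (S T : 'M[V]_n)
    (M : series V n) : prog V (series V n) :=
  mapM (fun X => (Y <- multiply mm S X ;; multiply mm Y T)) M.

(* M |-> M(t^2)                                                               *)
Definition square_var (V : Type) (n : nat) (M : series V n) :
    prog V (series V n) :=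
  (r <- mapM (fun X => (Y <- copy_mx X ;; Z <- zero_mx V n ;; Ret [:: Y; Z])) M ;;
   Ret (flatten r)).

(* M |-> t^(-1) M                                                             *)
Definition div_var (V : Type) (n : nat) (M : series V n) :
    prog V (series V n) :=
  (Z <- zero_mx V n ;; Ret (Z :: M)).

Definition ceil_div (V : Type) (x y : int) : prog V int :=
  (u <- Do (ZAdd x y) ;; v <- Do (ZSub u 1) ;; Do (ZDiv v y)).

Definition rescale (V : Type) (n : nat) (ck q : int) (M : series V n) :
    prog V (series V n) :=
  (q' <- Do (ZDiv q 2) ;;
   u <- ceil_div V ck q' ;;
   v <- ceil_div V ck q ;;
   w <- Do (ZMul 2 v) ;;
   even <- Do (ZEq u w) ;;
   M2 <- square_var M ;;
   if even then Ret M2 else div_var M2).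

Definition iteration (V : Type) (n m : nat) (mm : circuit V n)
    (solver : R_solver V) (c : 'I_m -> int) (N : int) (x : state V n m) :
    prog V (state V n m + int) :=
  let: State th q D B := x in
  (z <- Do FZero ;;
   ans <- solver n m (fun k => nth (const_mx z) (tnth B k) 0) ;;
   let: RAnswer S_ T_ r s := ans in
   B1 <- tupleM (fun k => truncate (2 * n ^ 2 * m) (tnth B k)) ;;
   u <- Do (ZMul 2 n%:Z) ;;
   v <- Do (ZSub u r%:Z) ;;
   value <- Do (ZSub v s%:Z) ;;
   optimal <- Do (ZLe n%:Z value) ;;
   if ~~ optimal then
     (B2 <- tupleM (fun k =>
              (M <- mul_lr mm S_ T_ (tnth B1 k) ;; shift r s M)) ;;
      d <- Do (ZAdd D n%:Z) ;;
      d' <- Do (ZSub d r%:Z) ;;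
      d'' <- Do (ZSub d' s%:Z) ;;
      Ret (inl (State th q d'' B2)))
   else
     (last_phase <- Do (ZEq th N) ;;
      if last_phase then Ret (inr D)
      else
        (B2 <- tupleM (fun k => rescale (c k) q (tnth B1 k)) ;;
         D' <- Do (ZMul 2 D) ;;
         th' <- Do (ZAdd th 1) ;;
         q' <- Do (ZDiv q 2) ;;
         Ret (inl (State th' q' D' B2))))).

Definition max_cost (V : Type) (m : nat) (c : 'I_m -> int) : prog V int :=
  foldM (fun k C => (b <- Do (ZLe C (c k)) ;; Ret (if b then c k else C)))
        (enum 'I_m) 0.

(* Returns (N, 2 ^ N) with N = ceil (log_2 C), for C > 0.                     *)
Definition ceil_log2 (V : Type) (C : int) : prog V (int * int) :=
  Loop (fun x : int * int =>
          (b <- Do (ZLe C x.2) ;;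
           if b then Ret (inr x)
           else (N <- Do (ZAdd x.1 1) ;; q <- Do (ZMul 2 x.2) ;;
                 Ret (inl (N, q)))))
       (0, 1).

Definition deg_det_cost_scaling (V : Type) (n m : nat) (mm : circuit V n)
    (solver : R_solver V) (A : 'I_m -> 'M[V]_n) (c : 'I_m -> int) :
    prog V int :=
  (C <- max_cost V c ;;
   Nq <- ceil_log2 V C ;;
   B <- tupleM (fun k => (M <- copy_mx (A k) ;; Ret [:: M])) ;;
   Loop (iteration mm solver c Nq.1) (State 0 Nq.2 n%:Z B)).

(* Main.v *)
Require Import Defs.
From HB Require Import structures.
From mathcomp Require Import all_boot all_order all_algebra.
From mathcomp Require Import perm generic_quotient zify ring lra.
From mathcomp Require Import boolp.
From mathcomp Require Import reals constructive_ereal ereal exp.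

(* With u = 1/t, a feasible pair of the minimization defining deg Det is, up   *)
(* to a scalar, a pair of polynomial matrices in u, and the algorithm keeps    *)
(* such a pair P, Q with P A_k Q = u^(a + c_k) B_k.  Let v be the order of     *)
(* vanishing at u = 0.  If every zero r x s block of S B(0) T (S, T            *)
(* invertible) has r + s <= n, then the pair is optimal: diagonalize two       *)
(* competitors over the local ring at u = 0, with diagonal valuations alpha_i  *)
(* and beta_j; divisibility of P B_k Q by u^e forces B(0) to have a zero block *)
(* on {alpha_i <= b} x {beta_j < e - b}, and summing the bound n on the sizes  *)
(* over b < e gives v(det P) + v(det Q) >= n e.  For the number of iterations, *)
(* 2 c_k - 1 <= c'_k when c' are the costs of the next phase, so that          *)
(* multiplying a pair by u compares the optimum of that phase with twice the   *)
(* previous one: they differ by at most n, and every Step 2 lowers the         *)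
(* objective, so a phase has at most n + 1 iterations.  A truncation at order  *)
(* 2 n^2 m >= 2 n cannot reach B(0) within a phase, and substituting u^2 for u *)
(* doubles the order of the error between two phases.                          *)

Set Implicit Arguments.
Unset Strict Implicit.
Unset Printing Implicit Defensive.

Import Order.TTheory GRing.Theory Num.Theory.
Local Open Scope ring_scope.

(** * Valuation at zero and diagonalization *)

Section PolyValuation.
Variable K : fieldType.
Implicit Types p q : {poly K}.

(** The algorithm carries a [certificate]: polynomial matrices P, Q in u = 1/t with P A_k Q = u^(a +
    c_k) B_k, whose [objective] is the number D held in the state. Step 2 multiplies the pair by
    constant and diagonal matrices ([certificate_shift]), Step 3 substitutes u^2 for u
    ([certificate_sqr]). Correctness rests on one criterion: if the zero blocks of B(0) have size at
    most n ([nc_full], which an optimal answer of value n to (R) guarantees by [R_optimal_full]),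
    the pair is optimal among polynomial pairs ([certificate_optimal], from [weak_duality]).
    [degDet_le] and [degDet_ge] transfer this to pairs over K(t).

    Termination and precision are governed by the gap between D and a lower bound for the current
    phase. Step 2 lowers it, and [scaled_lower_bound] caps it at n after Step 3; so N (n + 1) + 1
    iterations suffice, and truncation never disturbs B(0) ([runs_loop]). An iteration costs one
    call of (R) and O(n^2 m^2) matrix products, because each of the m series keeps at most 2 n^2 m
    terms; copying is absorbed by the products ([multiply_cost]). *)

Definition xval p := mup 0 p.

Lemma dvdXn_xval e p : p != 0 -> ('X^e %| p) = (e <= xval p)%N.
Proof. by move=> p0; rewrite /xval mup_geq // subr0. Qed.

Lemma xvalM p q : p != 0 -> q != 0 -> xval (p * q) = (xval p + xval q)%N.
Proof. exact: mupM. Qed.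

Lemma xvalXn e : xval ('X^e : {poly K}) = e.
Proof. by have := mup_XsubCX e (0 : K) 0; rewrite subr0 eqxx. Qed.

Lemma xval_unit p : p.[0] != 0 -> xval p = 0%N.
Proof. by move=> h; rewrite /xval mupNroot. Qed.

Lemma neq0_horner0 p : p.[0] != 0 -> p != 0.
Proof. by apply: contraNneq => ->; rewrite horner0. Qed.

Lemma xval_exp p e : p != 0 -> xval (p ^+ e) = (e * xval p)%N.
Proof.
move=> p0; elim: e => [|e IH]; first by rewrite expr0 mul0n xval_unit // hornerC oner_neq0.
by rewrite exprS xvalM ?expf_neq0 // IH mulSn.
Qed.

Lemma xval_prod n (f : 'I_n -> {poly K}) : (forall i, f i != 0) ->
  xval (\prod_i f i) = (\sum_i xval (f i))%N.
Proof.
move=> f0.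
suff [] : xval (\prod_i f i) = (\sum_i xval (f i))%N /\ \prod_i f i != 0 by [].
apply: (big_ind2 (fun p v => xval p = v /\ p != 0)) => //.
- by rewrite xval_unit ?hornerC ?oner_neq0.
- by move=> p v q w [<- p0] [<- q0]; rewrite xvalM // mulf_neq0.
Qed.

Lemma xval_factor p : p != 0 -> exists2 q, p = 'X^(xval p) * q & q.[0] != 0.
Proof.
move=> p0; have := dvdXn_xval (xval p) p0; rewrite leqnn => /dvdpP[q pq].
exists q; first by rewrite mulrC.
have q0 : q != 0 by apply: contraNneq p0 => q0; rewrite pq q0 mul0r.
apply/negP; rewrite -/(root q 0) -dvdp_XsubCl subr0 => /dvdpP[r qr].
have := dvdXn_xval (xval p).+1 p0; rewrite ltnn => /negP; apply.
by apply/dvdpP; exists r; rewrite {1}pq qr exprS mulrA.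
Qed.

Lemma dvdXn_horner e p : (0 < e)%N -> 'X^e %| p -> p.[0] = 0.
Proof.
case: e => // e _ /dvdpP[q ->].
by rewrite hornerM hornerXn expr0n mulr0.
Qed.

Lemma dvdXn_mxP e n (M : 'M[{poly K}]_n) :
  (forall i j, 'X^e %| M i j) <-> exists N, M = 'X^e *: N.
Proof.
split=> [h|[N ->] i j]; last by rewrite mxE dvdp_mulr.
exists (map_mx (fun p => p %/ 'X^e) M); apply/matrixP => i j.
by rewrite !mxE mulrC divpK.
Qed.

Lemma dvdXn_mx_mul e n (P Q M : 'M[{poly K}]_n) :
  (forall i j, 'X^e %| M i j) -> forall i j, 'X^e %| (P *m M *m Q) i j.
Proof.
move=> /dvdXn_mxP[N ->]; apply/dvdXn_mxP; exists (P *m N *m Q).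
by rewrite -scalemxAr -scalemxAl.
Qed.

(* Elimination over the localization of K[X] at (X): polynomials with nonzero  *)
(* constant term play the role of units, so no denominators are needed.        *)
Lemma local_smith n (P : 'M[{poly K}]_n) :
  exists U V : 'M[{poly K}]_n, exists d : 'rV_n,
    [/\ (\det U).[0] != 0, (\det V).[0] != 0 & U *m P *m V = diag_mx d].
Proof.
elim: n P => [|n IH] P.
  exists 1%:M, 1%:M, 0; rewrite !det1 hornerC oner_neq0; split=> //.
  by apply/matrixP => - [].
have [P0|nzP] := eqVneq P 0.
  exists 1%:M, 1%:M, 0; rewrite !det1 hornerC oner_neq0; split=> //.
  by rewrite P0 mulmx0 mul0mx; apply/matrixP => i j; rewrite !mxE mul0rn.
have [x0 nzx0] : exists x : 'I_n.+1 * 'I_n.+1, P x.1 x.2 != 0.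
  apply/existsP; apply: contraNT nzP; rewrite negb_exists => /forallP h.
  by apply/eqP/matrixP => i j; rewrite mxE; apply/eqP; have := h (i, j); rewrite negbK.
pose good (x : 'I_n.+1 * 'I_n.+1) := P x.1 x.2 != 0.
(* The pivot is an entry of least valuation e, so X^e divides every entry. *)
case: (@arg_minnP _ x0 good (fun x => xval (P x.1 x.2)) nzx0) => -[i0 j0] /= nz min.
have [P1 P1def] : {P1 : 'M_(1 + n) | P1 = tperm_mx 0 i0 *m P *m tperm_mx 0 j0} by eexists.
have P1E i j : P1 i j = P (tperm 0 i0 i) (tperm 0 j0 j).
  by rewrite P1def -xcolE -xrowE !mxE.
set e := xval (P i0 j0) in min.
have dvdP1 i j : 'X^e %| P1 i j.
  rewrite P1E; have [->|nzij] := eqVneq (P (tperm 0 i0 i) (tperm 0 j0 j)) 0; first exact: dvdp0.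
  rewrite dvdXn_xval //; exact: (min (_, _)).
have [u Pu nzu] := xval_factor nz; rewrite -/e in Pu.
pose div (p : {poly K}) := p %/ 'X^e.
have divK p : 'X^e %| p -> div p * 'X^e = p by exact: divpK.
have Xe : ('X^e : {poly K}) != 0 by rewrite expf_neq0 // polyX_eq0.
pose v' := map_mx div (dlsubmx P1); pose w' := map_mx div (ursubmx P1).
have vE : dlsubmx P1 = 'X^e *: v'.
  apply/matrixP => i j; rewrite !mxE mulrC divK //; exact: dvdP1.
have wE : ursubmx P1 = 'X^e *: w'.
  apply/matrixP => i j; rewrite !mxE mulrC divK //; exact: dvdP1.
have pE : ulsubmx P1 = ('X^e * u)%:M.
  apply/matrixP => i j; rewrite !ord1 !mxE eqxx mulr1n -Pu.
  have -> : lshift n (0 : 'I_1) = 0 by apply/val_inj.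
  by have := P1E 0 0; rewrite !tpermL; apply.
(* The pivot is X^e u with u(0) nonzero. Instead of dividing by u, the other rows and columns are
   scaled by it; the determinants of [U1] and [V1] stay nonzero at 0. *)
pose U1 : 'M_(1 + n) := block_mx 1%:M 0 (- v') u%:M.
pose V1 : 'M_(1 + n) := block_mx 1%:M (- w') 0 u%:M.
pose M := u%:M *m (('X^e *: v') *m (- w') + drsubmx P1 *m u%:M).
have E1 : U1 *m P1 *m V1 = block_mx (('X^e * u)%:M) 0 0 M.
  rewrite -mulmxA -[P1]submxK vE wE pE !mulmx_block.
  rewrite !mulmx0 !mul0mx !mulmx1 !mul1mx !addr0 ?add0r.
  have -> : ('X^e * u)%:M *m - w' + 'X^e *: w' *m u%:M = 0.
    by rewrite mul_scalar_mx mul_mx_scalar scalerN scalerA [u * _]mulrC addNr.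
  rewrite mulmx0 add0r; congr (block_mx _ _ _ _).
  by rewrite mul_mx_scalar mul_scalar_mx scalerN scalerA [u * _]mulrC addNr.
have [U2 [V2 [d [nU nV E2]]]] := IH M.
have detperm k : (\det (tperm_mx 0 k : 'M[{poly K}]_n.+1)).[0] != 0.
  by rewrite det_perm horner_exp hornerN hornerC signr_eq0.
exists ((block_mx 1%:M 0 0 U2 : 'M_(1 + n)) *m U1 *m tperm_mx 0 i0).
exists (tperm_mx 0 j0 *m (V1 *m (block_mx 1%:M 0 0 V2 : 'M_(1 + n)))).
exists (row_mx ('X^e * u)%:M d : 'rV_(1 + n)).
split.
- by rewrite !det_mulmx /U1 !(@det_lblock _ 1) !det1 !mul1r det_scalar !hornerM horner_exp !mulf_neq0 ?expf_neq0.
- by rewrite !det_mulmx /V1 !(@det_ublock _ 1) !det1 !mul1r det_scalar !hornerM horner_exp !mulf_neq0 ?expf_neq0.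
have -> : block_mx 1%:M 0 0 U2 *m U1 *m tperm_mx 0 i0 *m P *m
   (tperm_mx 0 j0 *m (V1 *m block_mx 1%:M 0 0 V2)) =
   (block_mx 1%:M 0 0 U2 : 'M_(1 + n)) *m (U1 *m P1 *m V1) *m (block_mx 1%:M 0 0 V2 : 'M_(1 + n)).
  by rewrite P1def !mulmxA.
rewrite E1 !mulmx_block !mulmx0 !mul0mx !mulmx1 !mul1mx !addr0 !add0r mul0mx E2.
have diag1 : ('X^e * u)%:M = diag_mx ('X^e * u)%:M :> 'M_1.
  by apply/matrixP => i j; rewrite !ord1 !mxE !eqxx !mulr1n.
rewrite [in LHS]diag1; apply/esym. have X := @diag_mx_row {poly K} n 1 ('X^e * u)%:M d. by refine (etrans X _); f_equal.
Qed.

End PolyValuation.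

(** * Weak duality for matrices without large zero blocks at u = 0 *)

Section WeakDuality.
Variables (K : fieldType) (n m : nat).
Implicit Types (B : 'I_m -> 'M[{poly K}]_n) (P Q : 'M[{poly K}]_n).

(** By the Fortin-Reutenauer theorem this says that sum_k B_k x_k is invertible over the free skew
    field. *)
Definition nc_full (B : 'I_m -> 'M[K]_n) := forall S T I J,
  S \in unitmx -> T \in unitmx -> zero_block B S T I J -> (#|I| + #|J| <= n)%N.

Definition mx_at0 P : 'M[K]_n := map_mx (horner_eval 0) P.

(** Exchanging sums, the total over a < e of #{i : alpha_i <= a} is at least n e - sum_i alpha_i,
    and likewise for beta after reversing a. By hypothesis the two totals together are at most n
    e. *)
Lemma threshold_count (alpha beta : 'I_n -> nat) (e : nat) :
  (forall a, (a < e)%N ->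
    (#|[set i | (alpha i <= a)%N]| + #|[set j | (beta j < e - a)%N]| <= n)%N) ->
  (n * e <= \sum_i alpha i + \sum_j beta j)%N.
Proof.
move=> h.
have row (f : 'I_n -> nat) (g : 'I_n -> nat -> bool) :
    (forall i, e <= f i + \sum_(a < e) g i a)%N ->
    (n * e <= \sum_i f i + \sum_(a < e) #|[set i | g i a]|)%N.
  move=> hf; have -> : (n * e = \sum_(i < n) e)%N by rewrite sum_nat_const card_ord.
  have -> : (\sum_(a < e) #|[set i | g i a]| = \sum_(a < e) \sum_i g i a)%N.
    by apply: eq_bigr => a _; rewrite -sum1dep_card big_mkcond /=; apply: eq_bigr => i _; case: (g i a).
  by rewrite exchange_big -big_split /=; apply: leq_sum => i _.
have cnt_le x : (e <= x + \sum_(a < e) (x <= a)%N)%N.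
  elim: (e) => [|f IH]; first by rewrite leq0n.
  rewrite big_ord_recr /=; move: IH; set S := (\sum_(_ < f) _)%N => IH.
  by case: (leqP x f) => H /=; lia.
have cnt_lt x : (e <= x + \sum_(a < e) (x < e - a)%N)%N.
  rewrite (reindex_inj rev_ord_inj) /= (leq_trans (cnt_le x)) // leq_add2l.
  by apply: leq_sum => i _; rewrite subKn ?ltn_ord // ltnS.
have h1 := row alpha (fun i a => (alpha i <= a)%N) (fun i => cnt_le (alpha i)).
have h2 := row beta (fun j a => (beta j < e - a)%N) (fun j => cnt_lt (beta j)).
have h3 : (\sum_(a < e) #|[set i | (alpha i <= a)%N]| + \sum_(a < e) #|[set j | (beta j < e - a)%N]| <= n * e)%N.
  rewrite -big_split /= (leq_trans (n := \sum_(a < e) n)%N) //; last by rewrite sum_nat_const card_ord mulnC.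
  by apply: leq_sum => a _; apply: h.
rewrite -(leq_add2r (n * e)) (leq_trans (leq_add h1 h2)) // addnACA leq_add2l //.
Qed.

Lemma mul_diag_mxE (d : 'rV[{poly K}]_n) (M : 'M_n) (d' : 'rV_n) i j :
  (diag_mx d *m M *m diag_mx d') i j = d 0 i * M i j * d' 0 j.
Proof. by rewrite mul_mx_diag mul_diag_mx !mxE. Qed.

Lemma unit_at0 P : (\det P).[0] != 0 -> mx_at0 (\adj P) \in unitmx.
Proof.
move=> h; rewrite unitmxE det_map_mx unitfE /horner_eval.
have : (\det P * \det (\adj P)).[0] != 0.
  by rewrite -det_mulmx mul_mx_adj det_scalar horner_exp expf_neq0.
by rewrite hornerM mulf_eq0 negb_or => /andP[].
Qed.

(** With P and Q diagonalized over the local ring, u^e divides d_i C_ij d'_j, where C is B_k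
    multiplied by matrices invertible at 0. If v(d_i) <= a and v(d'_j) < e - a, then C_ij vanishes
    at 0; this is a zero block for every a < e, and [threshold_count] adds up the bounds. *)
Lemma weak_duality B P Q e :
  nc_full (fun k => mx_at0 (B k)) -> \det P != 0 -> \det Q != 0 ->
  (forall k i j, 'X^e %| (P *m B k *m Q) i j) ->
  (n * e <= xval (\det P) + xval (\det Q))%N.
Proof.
move=> full nzP nzQ hB.
have [U [V [d [hU hV E]]]] := local_smith P.
have [U' [V' [d' [hU' hV' E']]]] := local_smith Q.
have vd (M W Z : 'M[{poly K}]_n) (f : 'rV_n) : \det M != 0 -> (\det W).[0] != 0 ->
    (\det Z).[0] != 0 -> W *m M *m Z = diag_mx f ->
    (forall i, f 0 i != 0) /\ xval (\det M) = (\sum_i xval (f 0%R i))%N.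
  move=> nzM hW hZ EM.
  have ED : \det W * \det M * \det Z = \prod_i f 0 i by rewrite -!det_mulmx EM det_diag.
  have nz i : f 0 i != 0.
    apply: contraNneq (mulf_neq0 (mulf_neq0 (neq0_horner0 hW) nzM) (neq0_horner0 hZ)) => f0.
    by rewrite ED (bigD1 i) //= f0 mul0r.
  split=> //; rewrite -xval_prod // -ED !xvalM ?mulf_neq0 // ?neq0_horner0 //.
  by rewrite (xval_unit hW) (xval_unit hZ) add0n addn0.
have [nzd ->] := vd _ _ _ _ nzP hU hV E.
have [nzd' ->] := vd _ _ _ _ nzQ hU' hV' E'.
apply: threshold_count => a lta.
pose S := mx_at0 (\adj V); pose T := mx_at0 (\adj U').
apply: (full S T); [exact: unit_at0|exact: unit_at0|].
move=> k i j; rewrite !inE => hi hj.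
pose C := \adj V *m B k *m \adj U'.
have -> : (S *m mx_at0 (B k) *m T) i j = (C i j).[0] by rewrite -!map_mxM mxE.
have key : 'X^e %| d 0 i * C i j * d' 0 j.
  have -> : d 0 i * C i j * d' 0 j = (diag_mx d *m C *m diag_mx d') i j.
    by rewrite mul_diag_mxE.
  (* The adjugates of V and U' replace their inverses, at the price of the scalars det V and det
     U'. *)
  have -> : diag_mx d *m C *m diag_mx d' = (\det V *: U) *m (P *m B k *m Q) *m (\det U' *: V').
    rewrite -E -E' /C !mulmxA.
    rewrite -(mulmxA _ V (\adj V)) mul_mx_adj -(mulmxA _ (\adj U') U') mul_adj_mx.
    by rewrite !mul_mx_scalar -!scalemxAl -!scalemxAr !scalerA [_ * \det V]mulrC.
  by apply: dvdXn_mx_mul.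
have [->|nzC] := eqVneq (C i j) 0; first by rewrite horner0.
move: key; rewrite dvdXn_xval ?mulf_neq0 // !xvalM ?mulf_neq0 // => key.
apply: (@dvdXn_horner _ 1%N) => //; rewrite dvdXn_xval //.
rewrite lt0n; apply/eqP => v0; move: key; rewrite v0 addn0 leqNgt => /negP; apply.
lia.
Qed.
End WeakDuality.

(** * Optimality certificates *)

Section Certificates.
Variables (K : fieldType) (n m : nat).
Implicit Types (A : 'I_m -> 'M[K]_n) (c : 'I_m -> nat) (P Q : 'M[{poly K}]_n).
Implicit Types (B : 'I_m -> 'M[{poly K}]_n) (a : nat).

Definition mxC (M : 'M[K]_n) : 'M[{poly K}]_n := map_mx polyC M.

(* The indeterminate of {poly K} is u = 1/t, so that the pair                  *)
(* (t^a P(1/t), Q(1/t)) is feasible for the minimization defining deg Det.     *)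
Definition pfeasible A c P Q a :=
  [/\ \det P != 0, \det Q != 0 &
      forall k i j, 'X^(a + c k) %| (P *m mxC (A k) *m Q) i j].

Definition objective P Q a : int :=
  (xval (\det P))%:Z + (xval (\det Q))%:Z - (n * a)%:Z.

Definition certificate A c P Q a B :=
  [/\ \det P != 0, \det Q != 0 &
      forall k, P *m mxC (A k) *m Q = 'X^(a + c k) *: B k].

Lemma certificate_feasible A c P Q a B :
  certificate A c P Q a B -> pfeasible A c P Q a.
Proof. by case=> nzP nzQ h; split=> // k; apply/dvdXn_mxP; exists (B k). Qed.

Lemma xval_adj (P : 'M[{poly K}]_n) : \det P != 0 ->
  \det (\adj P) != 0 /\ (xval (\det P) + xval (\det (\adj P)) = n * xval (\det P))%N.
Proof.
move=> nzP; have E : \det P * \det (\adj P) = \det P ^+ n.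
  by rewrite -det_mulmx mul_mx_adj det_scalar.
have nz : \det (\adj P) != 0.
  by apply: contraNneq (expf_neq0 n nzP) => h; rewrite -E h mulr0.
by split=> //; rewrite -xvalM // E xval_exp.
Qed.

(** Up to a power of u, P adj(P0) B_k adj(Q0) Q is det P0 det Q0 times P A_k Q, hence divisible by
    u^e with e = v(det P0) + v(det Q0) + a - a0. Since v(det P0) + v(det adj P0) = n v(det P0), and
    likewise for Q0, [weak_duality] becomes the comparison of objectives. *)
Lemma certificate_optimal A c P0 Q0 a0 B P Q a :
  certificate A c P0 Q0 a0 B -> nc_full (fun k => mx_at0 (B k)) ->
  pfeasible A c P Q a -> objective P0 Q0 a0 <= objective P Q a.
Proof.
move=> [nzP0 nzQ0 hB] full [nzP nzQ hd].
set p0 := xval (\det P0); set q0 := xval (\det Q0).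
pose e := (p0 + q0 + a - a0)%N.
have [nzaP vaP] := xval_adj nzP0; have [nzaQ vaQ] := xval_adj nzQ0.
have nz1 : \det (P *m \adj P0) != 0 by rewrite det_mulmx mulf_neq0.
have nz2 : \det (\adj Q0 *m Q) != 0 by rewrite det_mulmx mulf_neq0.
have : (n * e <= xval (\det (P *m \adj P0)) + xval (\det (\adj Q0 *m Q)))%N.
  apply: (weak_duality full nz1 nz2) => k i j.
  (* Subtraction is truncated: if a0 exceeds p0 + q0 + a, then e = 0 and the divisibility is
     trivial. *)
  have [le_a|lt_a] := leqP a0 (p0 + q0 + a); last by rewrite /e (eqP (ltnW lt_a)) expr0 dvd1p.
  have nzX : ('X^(a0 + c k) : {poly K}) != 0 by rewrite expf_neq0 // polyX_eq0.
  rewrite -(dvdp_mul2l _ _ nzX) -exprD.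
  have -> : 'X^(a0 + c k) * (P *m \adj P0 *m B k *m (\adj Q0 *m Q)) i j =
      (P *m \adj P0 *m ('X^(a0 + c k) *: B k) *m (\adj Q0 *m Q)) i j.
    by rewrite -scalemxAr -scalemxAl [RHS]mxE.
  rewrite -hB.
  have -> : P *m \adj P0 *m (P0 *m mxC (A k) *m Q0) *m (\adj Q0 *m Q) =
      (\det P0 * \det Q0) *: (P *m mxC (A k) *m Q).
    rewrite !mulmxA -(mulmxA _ (\adj P0) P0) mul_adj_mx -(mulmxA _ Q0 (\adj Q0)) mul_mx_adj.
    by rewrite !mul_mx_scalar -!scalemxAl scalerA mulrC.
  rewrite mxE; have -> : (a0 + c k + e = (p0 + q0) + (a + c k))%N by rewrite addnAC subnKC // addnA.
  rewrite exprD dvdp_mul //.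
  by rewrite dvdXn_xval ?mulf_neq0 // xvalM.
rewrite !det_mulmx !xvalM // /objective -/p0 -/q0.
have : (n * (p0 + q0 + a) <= n * (a0 + e))%N by rewrite leq_mul2l -leq_subLR leqnn orbT.
move: vaP vaQ; rewrite -/p0 -/q0 !mulnDr -/e; move: (n * e)%N (n * p0)%N (n * q0)%N (n * a)%N (n * a0)%N => x1 x2 x3 x4 x5.
clearbody p0 q0; move: (xval _) (xval _) (xval _) (xval _) => y1 y2 y3 y4.
by clear; lia.
Qed.

Lemma xval_comp_sqr (p : {poly K}) : p != 0 -> p \Po 'X^2 != 0 /\ xval (p \Po 'X^2) = (2 * xval p)%N.
Proof.
move=> /xval_factor[q E q0]; have h : (q \Po 'X^2).[0] != 0.
  by rewrite horner_comp hornerXn expr0n.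
have -> : p \Po 'X^2 = 'X^(2 * xval p) * (q \Po 'X^2).
  by rewrite [p in LHS]E comp_polyM comp_Xn_poly -exprM.
have X0 : ('X^(2 * xval p) : {poly K}) != 0 by rewrite expf_neq0 // polyX_eq0.
have q2 := neq0_horner0 h; split; first by rewrite mulf_neq0.
by rewrite xvalM // xvalXn (xval_unit h) addn0.
Qed.

Definition comp_sqr P := map_mx (comp_poly 'X^2) P.

(** For the costs of two consecutive phases the exponent is 0 or 1, the two cases of Step 3. *)
Definition scale_sqr c c' B k : 'M[{poly K}]_n := 'X^(2 * c k - c' k) *: comp_sqr (B k).

Lemma certificate_sqr A c c' P Q a B : (forall k, c' k <= 2 * c k)%N ->
  certificate A c P Q a B ->
  certificate A c' (comp_sqr P) (comp_sqr Q) (2 * a) (scale_sqr c c' B) /\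
  objective (comp_sqr P) (comp_sqr Q) (2 * a) = 2 * objective P Q a.
Proof.
move=> hc [nzP nzQ hB].
have [nzP' vP] := xval_comp_sqr nzP; have [nzQ' vQ] := xval_comp_sqr nzQ.
have dE M : \det (comp_sqr M) = \det M \Po 'X^2 by rewrite det_map_mx.
split; last by rewrite /objective !dE vP vQ; lia.
split; rewrite ?dE // => k.
have -> : mxC (A k) = comp_sqr (mxC (A k)).
  by apply/matrixP => i j; rewrite !mxE comp_polyC.
rewrite /comp_sqr -!map_mxM hB.
apply/matrixP => i j; rewrite !mxE /= comp_polyM comp_Xn_poly -exprM mulrA -exprD.
by congr ('X^_ * _); have := hc k; lia.
Qed.

(** Multiplying P by u makes a pair for c' feasible for the costs 2 c and raises its objective by n.
    For 2 c, substituting u^2 in the given certificate keeps B(0) and doubles the objective, so the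
    result is optimal there. *)
Lemma scaled_lower_bound A c c' P0 Q0 a0 B P Q a :
  (0 < n)%N -> certificate A c P0 Q0 a0 B -> nc_full (fun k => mx_at0 (B k)) ->
  (forall k, 2 * c k <= (c' k).+1)%N ->
  pfeasible A c' P Q a -> 2 * objective P0 Q0 a0 - n%:Z <= objective P Q a.
Proof.
move=> n0 cert full hc [nzP nzQ hd].
pose c2 k := (2 * c k)%N.
have [cert2 E2] := certificate_sqr (c' := c2) (fun k => leqnn _) cert.
have at0 k : mx_at0 (scale_sqr c c2 B k) = mx_at0 (B k).
  apply/matrixP => i j; rewrite !mxE /horner_eval hornerM hornerXn subnn expr0 mul1r.
  by rewrite horner_comp hornerXn expr0n.
have full2 : nc_full (fun k => mx_at0 (scale_sqr c c2 B k)).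
  move=> S T I J uS uT h; apply: (full S T) => // k i j Ii Jj.
  by rewrite -at0; apply: h.
have nzX : ('X^n : {poly K}) != 0 by rewrite expf_neq0 // polyX_eq0.
have feas : pfeasible A c2 ('X *: P) Q a.
  split=> // [|k]; first by rewrite detZ mulf_neq0.
  apply/dvdXn_mxP; have /dvdXn_mxP[N EN] := hd k.
  exists ('X^((c' k).+1 - c2 k) *: N).
  rewrite -!scalemxAl EN !scalerA -exprS -exprD; congr ('X^_ *: _).
  by move: (hc k); rewrite /c2; clear; lia.
have := certificate_optimal cert2 full2 feas; rewrite E2.
rewrite /objective detZ xvalM // xvalXn; move: (n * a)%N (n * a0)%N (xval _) (xval _) (xval _) (xval _); clear; lia.
Qed.

(** The matrix t^(1_r) is t times this diagonal matrix in u; the factor t goes into a, which grows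
    by one, and P stays polynomial. *)
Definition shift_left r (S : 'M[K]_n) P : 'M[{poly K}]_n :=
  diag_mx (\row_i 'X^(r <= i)%N) *m mxC S *m P.

Definition shift_right s (T : 'M[K]_n) Q : 'M[{poly K}]_n :=
  Q *m mxC T *m diag_mx (\row_(j < n) 'X^(j < n - s)%N).

(** [drop_poly 1] is the division by u that pays for the growth of a; it is exact when the upper
    right block vanishes at u = 0. *)
Definition shift_mx r s (S T : 'M[K]_n) B k : 'M[{poly K}]_n :=
  \matrix_(i, j) drop_poly 1
    ('X^((r <= i) + (j < n - s))%N * (mxC S *m B k *m mxC T) i j).

Lemma mx_at0C S : mx_at0 (mxC S) = S.
Proof. by apply/matrixP => i j; rewrite !mxE /horner_eval hornerC. Qed.

Lemma det_mxC S : \det (mxC S) = (\det S)%:P.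
Proof. by rewrite det_map_mx. Qed.

Lemma xval_det_diagX (b : 'I_n -> bool) :
  \det (diag_mx (\row_i 'X^(b i)) : 'M[{poly K}]_n) != 0 /\
  xval (\det (diag_mx (\row_i 'X^(b i)) : 'M[{poly K}]_n)) = #|[pred i | b i]|.
Proof.
have nz i : ((\row_i 'X^(b i)) 0 i : {poly K}) != 0 by rewrite mxE expf_neq0 // polyX_eq0.
rewrite det_diag; split; first by apply/prodf_neq0.
rewrite xval_prod // -sum1_card [RHS]big_mkcond; apply: eq_bigr => i _.
by rewrite mxE xvalXn inE; case: (b i).
Qed.

Lemma mul_mxC_unit S P : S \in unitmx -> \det P != 0 ->
  \det (mxC S *m P) != 0 /\ xval (\det (mxC S *m P)) = xval (\det P).
Proof.
rewrite unitmxE unitfE => nzS nzP; have nz : (\det (mxC S)).[0] != 0.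
  by rewrite det_mxC hornerC.
by rewrite det_mulmx mulf_neq0 ?xvalM // ?neq0_horner0 // xval_unit.
Qed.

Lemma card_ord_lt s : (s <= n)%N -> #|[pred j : 'I_n | (j < s)%N]| = s.
Proof.
move=> les; rewrite -sum1_card (eq_bigl (fun j : 'I_n => (j < s)%N)); last by move=> j; rewrite inE.
by rewrite -(big_ord_widen _ (fun _ => 1%N) les) sum1_card card_ord.
Qed.

Lemma card_ord_ge r : (r <= n)%N -> #|[pred i : 'I_n | (r <= i)%N]| = (n - r)%N.
Proof.
move=> ler; have := cardC [pred i : 'I_n | (i < r)%N]; rewrite card_ord_lt // card_ord.
have -> : #|[predC [pred i : 'I_n | (i < r)%N]]| = #|[pred i : 'I_n | (r <= i)%N]|.
  by apply: eq_card => i; rewrite !inE /=; rewrite -leqNgt.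
by move=> E; apply/eqP; rewrite -(eqn_add2l r) E subnKC.
Qed.

Lemma shift_dets r s S T P Q :
  S \in unitmx -> T \in unitmx -> (r <= n)%N -> (s <= n)%N ->
  \det P != 0 -> \det Q != 0 ->
  [/\ \det (shift_left r S P) != 0, \det (shift_right s T Q) != 0,
      xval (\det (shift_left r S P)) = (n - r + xval (\det P))%N &
      xval (\det (shift_right s T Q)) = (n - s + xval (\det Q))%N].
Proof.
move=> uS uT ler les nzP nzQ.
have [nz1 v1] := xval_det_diagX (fun i => (r <= i)%N).
have [nz2 v2] := xval_det_diagX (fun j => (j < n - s)%N).
have [nz3 v3] := mul_mxC_unit uS nzP.
have [nz4 v4] := mul_mxC_unit uT nzQ.
rewrite /shift_left /shift_right -mulmxA !det_mulmx -!det_mulmx.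
rewrite !det_mulmx [\det Q * _]mulrC -!(det_mulmx (mxC _)).
rewrite !mulf_neq0 // !xvalM // v1 v2 v3 v4 card_ord_ge ?card_ord_lt ?leq_subr //.
by split=> //; rewrite addnC.
Qed.

Lemma certificate_shift A c P Q a B r s S T :
  certificate A c P Q a B ->
  S \in unitmx -> T \in unitmx -> (r <= n)%N -> (s <= n)%N ->
  zero_block (fun k => mx_at0 (B k)) S T [set i : 'I_n | (i < r)%N]
     [set j : 'I_n | (n - s <= j)%N] ->
  certificate A c (shift_left r S P) (shift_right s T Q) a.+1 (shift_mx r s S T B) /\
  objective (shift_left r S P) (shift_right s T Q) a.+1 =
    objective P Q a + n%:Z - r%:Z - s%:Z.
Proof.
move=> [nzP nzQ hB] uS uT ler les hz.
have [nzP' nzQ' vP vQ] := shift_dets uS uT ler les nzP nzQ.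
split; last by rewrite /objective vP vQ; nia.
split=> // k.
have -> : shift_left r S P *m mxC (A k) *m shift_right s T Q =
    diag_mx (\row_i 'X^(r <= i)%N) *m (mxC S *m (P *m mxC (A k) *m Q) *m mxC T)
    *m diag_mx (\row_(j < n) 'X^(j < n - s)%N).
  by rewrite /shift_left /shift_right !mulmxA.
rewrite hB -scalemxAr -scalemxAl -scalemxAr -scalemxAl.
rewrite addSn exprSr -scalerA; congr (_ *: _).
apply/matrixP => i j; rewrite mul_diag_mxE [RHS]mxE [shift_mx _ _ _ _ _ _ _ _]mxE.
set C := (mxC S *m B k *m mxC T) i j; rewrite !mxE.
rewrite mulrAC -exprD; set p := _ * C.
(* Either a diagonal factor contributes a power of u, or the entry lies in the zero block. *)
have p0 : p`_0 = 0.
  rewrite /p coefXnM; case: posnP => // /eqP; rewrite addn_eq0 !eqb0 -ltnNge -leqNgt => /andP[hi hj].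
  have := hz k i j; rewrite !inE => /(_ hi hj).
  rewrite sub0n -horner_coef0 => E; rewrite -[RHS]E.
  by rewrite -{1}(mx_at0C S) -{1}(mx_at0C T) -!map_mxM [RHS]mxE.
apply/polyP => -[|l]; first by rewrite coefXM.
by rewrite coefXM /= coef_drop_poly addn1.
Qed.

End Certificates.

(** * Degrees of rational functions *)

Section RationalDegree.
Variable (K : fieldType).
Local Notation F := {fraction {poly K}}.
Local Notation tofrac := (@FracField.tofrac {poly K}).
Implicit Types (x y : F) (p q : {poly K}).

Lemma fracE x : x = tofrac \n_(repr x) / tofrac \d_(repr x).
Proof.
rewrite -{1}[x]reprK; set r := repr x.
have nz : tofrac \d_r != 0 by rewrite tofrac_eq0 denom_ratioP.
apply: (mulIf nz); rewrite mulfVK //.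
unlock FracField.tofrac; rewrite -[LHS]FracField.pi_mul; apply/eqmodP.
rewrite /= FracField.equivfE /FracField.mulf /=.
rewrite !numden_Ratio ?(oner_neq0, mulf_neq0, denom_ratioP) //.
by rewrite !mulr1 mulrC.
Qed.

Definition ideg x : int := (size \n_(repr x))%:Z - (size \d_(repr x))%:Z.

Lemma num_neq0 x : x != 0 -> \n_(repr x) != 0.
Proof. by apply: contraNneq => n0; rewrite [x]fracE n0 tofrac0 mul0r. Qed.

Lemma ideg_frac p q : p != 0 -> q != 0 ->
  ideg (tofrac p / tofrac q) = (size p)%:Z - (size q)%:Z.
Proof.
move=> p0 q0; set x := _ / _.
have x0 : x != 0 by rewrite mulf_neq0 ?invr_neq0 ?tofrac_eq0.
have dx0 := denom_ratioP (repr x); have nx0 := num_neq0 x0.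
have E : p * \d_(repr x) = \n_(repr x) * q.
  apply/eqP; rewrite -tofrac_eq !tofracM -eqr_div ?tofrac_eq0 //.
  by rewrite -[X in _ == X]fracE.
have := congr1 (fun s : {poly K} => size s) E; rewrite !size_mul //.
have := size_poly_gt0 p; have := size_poly_gt0 q; have := size_poly_gt0 \d_(repr x); have := size_poly_gt0 \n_(repr x).
rewrite p0 q0 dx0 nx0 /ideg.
move: (size p) (size q) (size _) (size _); clear; lia.
Qed.

Lemma idegM x y : x != 0 -> y != 0 -> ideg (x * y) = ideg x + ideg y.
Proof.
move=> x0 y0; rewrite {1}[x]fracE {1}[y]fracE mulrACA -invfM -!tofracM.
have [dx dy] := (denom_ratioP (repr x), denom_ratioP (repr y)).
have [nx ny] := (num_neq0 x0, num_neq0 y0).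
rewrite ideg_frac ?mulf_neq0 // !size_mul // /ideg.
have := size_poly_gt0 \d_(repr x); have := size_poly_gt0 \n_(repr x).
have := size_poly_gt0 \d_(repr y); have := size_poly_gt0 \n_(repr y).
rewrite dx dy nx ny; move: (size _) (size _) (size _) (size _); clear; lia.
Qed.

Lemma ideg_tofrac p : p != 0 -> ideg (tofrac p) = (size p)%:Z - 1.
Proof.
move=> p0; rewrite -[tofrac p]divr1 -tofrac1 ideg_frac ?oner_neq0 //.
by rewrite size_poly1.
Qed.

Lemma ideg1 : ideg 1 = 0.
Proof. by rewrite -tofrac1 ideg_tofrac ?oner_neq0 // size_poly1. Qed.

Lemma idegV x : x != 0 -> ideg x^-1 = - ideg x.
Proof.
move=> x0; apply/eqP; rewrite -addr_eq0 addrC -idegM ?invr_neq0 //.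
by rewrite mulfV // ideg1.
Qed.

Lemma idegX x e : x != 0 -> ideg (x ^+ e) = ideg x *+ e.
Proof.
move=> x0; elim: e => [|e IH]; first by rewrite expr0 ideg1.
by rewrite exprS idegM ?expf_neq0 // IH mulrS.
Qed.

Lemma rdegE (R : realType) x :
  rdeg R x = if x == 0 then -oo%E else ((ideg x)%:~R)%:E.
Proof. by rewrite /rdeg /ideg; case: eqP => // _; rewrite intrB. Qed.

(* Locked, because the // and by tactics would otherwise try to compute in F.   *)
Definition fracX : F := locked (tofrac 'X).

Lemma fracXE : fracX = tofrac 'X.
Proof. by rewrite /fracX -lock. Qed.

Lemma fracX_neq0 : fracX != 0.
Proof. by rewrite fracXE tofrac_eq0 polyX_eq0. Qed.

Lemma fracXn_neq0 d : fracX ^+ d != 0.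
Proof. exact: expf_neq0 d fracX_neq0. Qed.


Lemma ideg_fracX : ideg fracX = 1.
Proof. by rewrite fracXE ideg_tofrac ?polyX_eq0 // size_polyX. Qed.

Lemma ideg_fracXn d : ideg (fracX ^+ d) = d%:Z.
Proof. by rewrite (idegX d fracX_neq0) ideg_fracX natz. Qed.


Definition atV : {poly K} -> F :=
  horner_eval fracX^-1 \o map_poly (tofrac \o polyC).

HB.instance Definition _ := GRing.RMorphism.copy atV
  (horner_eval fracX^-1 \o map_poly (tofrac \o polyC)).

Lemma atVC (a : K) : atV a%:P = rconst a.
Proof. by rewrite /atV /= map_polyC /horner_eval hornerC. Qed.

Lemma atVX : atV 'X = fracX^-1.
Proof. by rewrite /atV /= map_polyX /horner_eval hornerX. Qed.

(** This is t^d p(1/t) when deg p <= d; through it [atV], the substitution of 1/t for u, is computed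
    and inverted. *)
Definition rev_poly d p := \poly_(i < d.+1) p`_(d - i).

Lemma atV_rev d p : (size p <= d.+1)%N ->
  fracX ^+ d * atV p = tofrac (rev_poly d p).
Proof.
move=> sz; have E : p = \sum_(i < d.+1) (p`_i)%:P * 'X^i.
  apply/polyP => i; rewrite coef_sum; under eq_bigr do rewrite coefCM coefXn.
  have [lt|le] := ltnP i d.+1.
    rewrite (bigD1 (Ordinal lt)) //= eqxx mulr1 big1 ?addr0 // => j nj.
    by rewrite -(inj_eq val_inj) eq_sym in nj; rewrite (negbTE nj) mulr0.
  rewrite nth_default ?(leq_trans sz) // big1 // => j _.
  by rewrite gtn_eqF ?mulr0 // (leq_trans (ltn_ord j)).
rewrite {1}E /rev_poly poly_def !rmorph_sum mulr_sumr (reindex_inj rev_ord_inj) /=.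
apply: eq_bigr => i _; rewrite subSS rmorphM rmorphXn /= atVC atVX.
rewrite -mul_polyC tofracM tofracXn -fracXE mulrCA; congr (_ * _).
rewrite exprVn -{1}(subnK (leq_subr i d)) exprD (mulfK (fracXn_neq0 _)).
by rewrite subKn // -ltnS.
Qed.

Lemma rev_polyK d p : (size p <= d.+1)%N -> rev_poly d (rev_poly d p) = p.
Proof.
move=> sz; apply/polyP => i; rewrite !coef_poly.
have [lt|le] := ltnP i d.+1; last by rewrite nth_default // (leq_trans sz).
by rewrite ltnS leq_subr subKn.
Qed.

Lemma size_rev_poly d p : (size (rev_poly d p) <= d.+1)%N.
Proof. exact: size_poly. Qed.

Lemma atV_neq0 p : p != 0 -> atV p != 0.
Proof.
move=> p0; have sz : (size p <= (size p).+1)%N by [].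
apply: contraNneq p0 => E; have := atV_rev sz; rewrite E mulr0 => /esym/eqP.
rewrite tofrac_eq0 => /eqP E2; rewrite -[p](rev_polyK sz) E2.
by apply/eqP/polyP => i; rewrite coef_poly !coef0 if_same.
Qed.

(** Write p = u^v q with q(0) nonzero and d = deg q. Then t^d q(1/t) has degree exactly d, so q(1/t)
    has degree 0 and only u^v contributes. *)
Lemma ideg_atV p : p != 0 -> ideg (atV p) = - (xval p)%:Z.
Proof.
move=> p0; have [q E q0] := xval_factor p0; rewrite E rmorphM rmorphXn /= atVX -E.
have nzq := neq0_horner0 q0.
have nzV : fracX^-1 != 0 by rewrite invr_neq0 // fracX_neq0.
rewrite (idegM (expf_neq0 _ nzV) (atV_neq0 nzq)) (idegX _ nzV) (idegV fracX_neq0) ideg_fracX.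
suff -> : ideg (atV q) = 0 by rewrite addr0 mulNrn natz.
pose d := (size q).-1; have szq : size q = d.+1 by rewrite prednK // size_poly_gt0.
have szq' : (size q <= d.+1)%N by rewrite szq.
have szr : size (rev_poly d q) = d.+1.
  by rewrite /rev_poly size_poly_eq // subnn -horner_coef0.
have nzr : rev_poly d q != 0 by rewrite -size_poly_gt0 szr.
have Ed := congr1 ideg (atV_rev szq').
rewrite (idegM (fracXn_neq0 d) (atV_neq0 nzq)) ideg_fracXn (ideg_tofrac nzr) szr -addn1 PoszD addrK in Ed.
by apply: (addrI d%:Z); rewrite Ed addr0.
Qed.

End RationalDegree.

(** * Pairs over K(t) and polynomial pairs in u *)

Section DegDetBridge.
Variables (R : realType) (K : fieldType) (n m : nat).
Variables (A : 'I_m -> 'M[K]_n) (c : 'I_m -> nat).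
Local Notation F := {fraction {poly K}}.
Local Notation tofrac := (@FracField.tofrac {poly K}).

Lemma feasible_entries (h1 h2 : F) (P Q : 'M[{poly K}]_n) k i j :
  ((h1 *: map_mx (@atV K) P) *m map_mx (@rconst K) (A k) *m
     (h2 *: map_mx (@atV K) Q)) i j =
  h1 * h2 * atV ((P *m mxC (A k) *m Q) i j).
Proof.
have -> : map_mx (@rconst K) (A k) = map_mx (@atV K) (mxC (A k)).
  by apply/matrixP => x y; rewrite !mxE atVC.
rewrite -scalemxAr -!scalemxAl scalerA -!map_mxM !mxE mulrC.
by rewrite [h2 * h1]mulrC mulrC.
Qed.

Lemma rdeg_det (h : F) (P : 'M[{poly K}]_n) : h != 0 -> \det P != 0 ->
  rdeg R (\det (h *: map_mx (@atV K) P)) =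
  ((ideg h *+ n - (xval (\det P))%:Z)%:~R)%:E.
Proof.
move=> nzh nzP; rewrite detZ det_map_mx rdegE mulf_eq0 expf_eq0.
rewrite (negbTE nzh) andbF (negbTE (atV_neq0 nzP)) /=.
by rewrite (idegM (expf_neq0 n nzh) (atV_neq0 nzP)) (idegX n nzh) (ideg_atV nzP).
Qed.

Lemma unitmx_scaled_atV (h : F) (P : 'M[{poly K}]_n) : h != 0 -> \det P != 0 ->
  h *: map_mx (@atV K) P \in unitmx.
Proof.
move=> nzh nzP; rewrite unitmxE unitfE detZ det_map_mx.
exact: mulf_neq0 (expf_neq0 n nzh) (atV_neq0 nzP).
Qed.

Lemma pfeasible_value (h1 h2 : F) (P Q : 'M[{poly K}]_n) a :
  h1 != 0 -> h2 != 0 -> ideg h1 + ideg h2 = a%:Z ->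
  \det P != 0 -> \det Q != 0 ->
  (- rdeg R (\det (h1 *: map_mx (@atV K) P)) -
     rdeg R (\det (h2 *: map_mx (@atV K) Q)))%E = ((objective P Q a)%:~R)%:E.
Proof.
move=> nz1 nz2 E nzP nzQ; rewrite (rdeg_det nz1 nzP) (rdeg_det nz2 nzQ).
rewrite -EFinN -EFinN -EFinD.
rewrite -2!intrN -intrD.
congr ((_%:~R)%:E); rewrite /objective.
have -> : ideg h2 = a%:Z - ideg h1 by rewrite -E addrC addKr.
have mulrnE (x : int) : x *+ n = x * n%:Z by rewrite -mulr_natr natz.
by rewrite !mulrnE PoszM; ring.
Qed.

Lemma degDet_le (P Q : 'M[{poly K}]_n) a : pfeasible A c P Q a ->
  (degDet R A c <= ((objective P Q a)%:~R)%:E)%E.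
Proof.
move=> [nzP nzQ hd]; apply: ereal_inf_lbound.
have nzX := fracXn_neq0 K a.
exists (fracX K ^+ a *: map_mx (@atV K) P), (1 *: map_mx (@atV K) Q).
have nz1 : 1 != 0 :> F by exact: oner_neq0.
have da : ideg (fracX K ^+ a) + ideg (1 : F) = a%:Z.
  by rewrite ideg1 addr0 ideg_fracXn.
split; last by rewrite (pfeasible_value nzX nz1 da).
split.
- exact: unitmx_scaled_atV nzX nzP.
- exact: unitmx_scaled_atV nz1 nzQ.
move=> k i j; rewrite feasible_entries mulr1 rdegE.
have := hd k i j; set p := (P *m _ *m _) i j.
have [->|nzp] := eqVneq p 0; first by rewrite rmorph0 mulr0 eqxx addNye leNye.
rewrite dvdXn_xval // => hv.
rewrite mulf_eq0 (negbTE nzX) (negbTE (atV_neq0 nzp)) /=.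
rewrite (idegM nzX (atV_neq0 nzp)) (ideg_atV nzp) ideg_fracXn.
rewrite -EFinD lee_fin -[(c k)%:R]/((c k)%:~R) -intrD lerz0.
by move: hv; move: (xval p) (c k); clear; lia.
Qed.

(** A common denominator f makes the entries polynomials in t, and reversal at a large degree d
    makes them polynomials in 1/t, with h = t^d / f. The sign of deg h matters: the degrees of two
    such scalars must add up to the natural number a of [pfeasible]. *)
Lemma clear_denominators (P : 'M[F]_n) :
  exists N : 'M[{poly K}]_n, exists h : F,
    [/\ h != 0, 0 <= ideg h & P = h *: map_mx (@atV K) N].
Proof.
pose den (x : 'I_n * 'I_n) := \d_(repr (P x.1 x.2)).
have nzd x : den x != 0 by exact: denom_ratioP.
pose f := \prod_x den x.
have nzf : f != 0 by apply/prodf_neq0.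
pose N0 : 'M[{poly K}]_n := \matrix_(i, j) (\n_(repr (P i j)) * (f %/ den (i, j))).
(* The sizes of the entries make the reversal lossless; the size of f makes deg h nonnegative. *)
pose d := (size f + \sum_x size (N0 x.1 x.2))%N.
have szN i j : (size (N0 i j) <= d.+1)%N.
  by rewrite /d (bigD1 (i, j)) //= addnCA -addnS leq_addr.
exists (map_mx (rev_poly d) N0), (fracX K ^+ d / tofrac f).
have nzX := fracXn_neq0 K d.
have nzF : tofrac f != 0 by rewrite tofrac_eq0.
have nzV := invr_neq0 nzF.
split; first exact: mulf_neq0 nzX nzV.
  rewrite (idegM nzX nzV) (idegV nzF) ideg_fracXn (ideg_tofrac nzf) /d.
  move: (size f) (\sum_x _)%N; clear; lia.
apply/matrixP => i j; rewrite !mxE -mulrA [_^-1 * _]mulrC mulrA.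
have := szN i j; rewrite mxE => sz.
rewrite atV_rev ?size_rev_poly // rev_polyK // tofracM -mulrA.
rewrite {1}[P i j]fracE; congr (_ * _); apply: (mulIf nzF).
rewrite (mulfVK nzF) mulrC.
have dvd : den (i, j) %| f by rewrite /f (bigD1 (i, j)) //= dvdp_mulr.
have nzFd : tofrac (den (i, j)) != 0 by rewrite tofrac_eq0 nzd.
by rewrite -{1}(divpK dvd) tofracM (mulfK nzFd).
Qed.

Lemma degDet_ge (D : int) :
  (forall P Q a, pfeasible A c P Q a -> D <= objective P Q a) ->
  (((D%:~R)%:E : \bar R) <= degDet R A c)%E.
Proof.
move=> h; apply: le_ereal_inf_tmp => _ [P' [Q' [[uP uQ hf] ->]]].
have [P [h1 [nz1 ge1 EP]]] := clear_denominators P'.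
have [Q [h2 [nz2 ge2 EQ]]] := clear_denominators Q'.
have nzP : \det P != 0.
  move: uP; rewrite unitmxE unitfE EP detZ det_map_mx mulf_eq0 negb_or => /andP[_].
  by apply: contraNneq => ->; rewrite rmorph0.
have nzQ : \det Q != 0.
  move: uQ; rewrite unitmxE unitfE EQ detZ det_map_mx mulf_eq0 negb_or => /andP[_].
  by apply: contraNneq => ->; rewrite rmorph0.
have [a Ea] : exists a : nat, ideg h1 + ideg h2 = a%:Z.
  by exists (absz (ideg h1 + ideg h2)); rewrite gez0_abs // addr_ge0.
rewrite EP EQ (pfeasible_value nz1 nz2 Ea) // lee_fin ler_int.
apply: h; split=> // k i j.
have := hf k i j; rewrite EP EQ feasible_entries rdegE.
set p := (P *m _ *m _) i j.
have [->|nzp] := eqVneq p 0; first by rewrite dvdp0.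
rewrite !mulf_eq0 (negbTE nz1) (negbTE nz2) (negbTE (atV_neq0 nzp)) /=.
rewrite -EFinD lee_fin -[(c k)%:R]/((c k)%:~R) -intrD lerz0.
rewrite (idegM (mulf_neq0 nz1 nz2) (atV_neq0 nzp)) (idegM nz1 nz2) Ea (ideg_atV nzp) (dvdXn_xval _ nzp).
by move: (xval p) (c k); clear; lia.
Qed.

(** If |I| + |J| > n for some zero block, the rows outside I and the columns outside J can be
    multiplied by u^M. With a = M - C the pair is feasible, and its objective is at most n C - M for
    every M >= C, so the infimum would be -oo. *)
Lemma initial_full : (-oo < degDet R A c)%E -> nc_full A.
Proof.
move=> hA S T I J uS uT hz; rewrite leqNgt; apply/negP => ltn.
pose C := (\max_(k < m) c k)%N.
have ub M : (C <= M)%N -> (degDet R A c <= (((n * C)%:Z - M%:Z)%:~R)%:E)%E.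
  move=> leC.
  pose P := diag_mx (\row_i 'X^(M * (i \notin I))) *m mxC S.
  pose Q := mxC T *m diag_mx (\row_j 'X^(M * (j \notin J))).
  have dX (b : {set 'I_n}) : \det (diag_mx (\row_i 'X^(M * (i \notin b))) : 'M[{poly K}]_n) != 0 /\
     xval (\det (diag_mx (\row_i 'X^(M * (i \notin b))) : 'M[{poly K}]_n)) = (M * #|~: b|)%N.
    have nz i : ((\row_i 'X^(M * (i \notin b))) 0 i : {poly K}) != 0.
      by rewrite mxE expf_neq0 // polyX_eq0.
    rewrite det_diag; split; first by apply/prodf_neq0.
    rewrite xval_prod // -sum1_card big_distrr [RHS]big_mkcond /=; apply: eq_bigr => i _.
    by rewrite mxE xvalXn inE; case: (i \in b); rewrite ?muln0 ?muln1.
  have [nz1 v1] := dX I; have [nz2 v2] := dX J.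
  have dC (W : 'M[K]_n) : W \in unitmx -> (\det (mxC W)).[0] != 0.
    by rewrite unitmxE unitfE det_mxC hornerC.
  have feas : pfeasible A c P Q (M - C).
    split=> [||k i j].
    - by rewrite det_mulmx (mulf_neq0 nz1 (neq0_horner0 (dC _ uS))).
    - by rewrite det_mulmx (mulf_neq0 (neq0_horner0 (dC _ uT)) nz2).
    have -> : P *m mxC (A k) *m Q = diag_mx (\row_i 'X^(M * (i \notin I))) *m
        mxC (S *m A k *m T) *m diag_mx (\row_j 'X^(M * (j \notin J))).
      by rewrite /mxC !map_mxM /P /Q !mulmxA.
    rewrite mul_diag_mxE [mxC _ _ _]mxE.
    rewrite ![(\row__ _) _ _]mxE.
    have leM : (M - C + c k <= M)%N.
      have : (c k <= C)%N by exact: leq_bigmax.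
      by move: leC; clear; lia.
    have [Ii|nI] := boolP (i \in I); last first.
      by rewrite muln1 -mulrA dvdp_mulr // dvdp_exp2l.
    have [Jj|nJ] := boolP (j \in J); last by rewrite muln1 dvdp_mull // dvdp_exp2l.
    by rewrite hz // mulr0 mul0r dvdp0.
  apply: (le_trans (degDet_le feas)); rewrite lee_fin ler_int.
  rewrite /objective !det_mulmx.
  rewrite (xvalM nz1 (neq0_horner0 (dC _ uS))) (xvalM (neq0_horner0 (dC _ uT)) nz2).
  rewrite (xval_unit (dC _ uS)) (xval_unit (dC _ uT)) v1 v2 addn0 add0n.
  have := cardsC I; have := cardsC J; rewrite card_ord.
  move: leC ltn; move: #|I| #|J| #|~: I| #|~: J|; clear => x y z w; nia.
have [/= r Er] : exists r : R, degDet R A c = r%:E.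
  case: (degDet R A c) hA ub => [r _ _|_ /(_ C (leqnn _)) //|//]; by exists r.
pose z : R := `|(n * C)%:R - r|.
pose M := (C + (Num.truncn z).+1)%N.
have : r <= (n * C)%:R - M%:R.
  by have := ub M (leq_addr _ _); rewrite Er lee_fin intrB.
apply/negP; rewrite -ltNge ltrBlDr -ltrBlDl.
apply: (le_lt_trans (ler_norm _)).
by apply: (lt_le_trans (truncnS_gt _)); rewrite ler_nat /M leq_addl.
Qed.

End DegDetBridge.

(** * Running times *)

Section Running.
Variable K : fieldType.
Local Open Scope nat_scope.

Definition runs (A : Type) (p : prog K A) (a : A) (T : nat) :=
  exists2 t : nat, exec p a t & (t <= T)%N.

Lemma runs_le A (p : prog K A) a T T' : runs p a T -> (T <= T')%N -> runs p a T'.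
Proof. by case=> t et le le'; exists t => //; apply: leq_trans le'. Qed.

Lemma runs_ret A (a : A) T : runs (Ret a) a T.
Proof. by exists 0%N => //; constructor. Qed.

Lemma runs_do A (o : instr K A) T : runs (Do o) (instr_sem o) T.+1.
Proof. by exists 1%N => //; constructor. Qed.

Lemma runs_bind A B (p : prog K A) (f : A -> prog K B) a b T U :
  runs p a T -> runs (f a) b U -> runs (Bind p f) b (T + U).
Proof. by move=> [t et le] [u eu leu]; exists (t + u)%N; [apply: exec_bind eu|apply: leq_add]. Qed.

Lemma runs_bind_do A B (o : instr K A) (f : A -> prog K B) b U :
  runs (f (instr_sem o)) b U -> runs (Bind (Do o) f) b U.+1.
Proof. by rewrite -add1n; apply: runs_bind; apply: runs_do. Qed.

Lemma runs_stop S A (body : S -> prog K (S + A)) s a T :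
  runs (body s) (inr a) T -> runs (Loop body s) a T.
Proof. by case=> t et le; exists t => //; apply: exec_stop. Qed.

Lemma runs_next S A (body : S -> prog K (S + A)) s s' a T U :
  runs (body s) (inl s') T -> runs (Loop body s') a U -> runs (Loop body s) a (T + U).
Proof. by move=> [t et le] [u eu leu]; exists (t + u)%N; [apply: exec_next eu|apply: leq_add]. Qed.

Lemma runs_mapM X A (f : X -> prog K A) (g : X -> A) (s : seq X) T :
  (forall x, runs (f x) (g x) T) -> runs (mapM f s) (map g s) (size s * T).
Proof.
move=> h; elim: s => [|x s IH] /=; first exact: runs_ret.
rewrite mulSn; apply: runs_bind (h x) _; rewrite -[_ * _]addn0.
exact: runs_bind IH (runs_ret _ _).
Qed.

Lemma runs_tupleM A n (f : 'I_n -> prog K A) (g : 'I_n -> A) T :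
  (forall i, runs (f i) (g i) T) -> runs (tupleM f) [tuple g i | i < n] (n * T).
Proof.
elim: n f g => [|n IH] f g h /=.
  by rewrite [X in runs _ X _](_ : _ = [tuple]); [exact: runs_ret|exact: tuple0].
have -> : [tuple g i | i < n.+1] = [tuple of g ord0 :: [tuple g (lift ord0 i) | i < n]].
  apply: eq_from_tnth => i; rewrite tnth_mktuple; case: (unliftP ord0 i) => [j|] ->.
    by rewrite tnthS tnth_mktuple.
  by rewrite tnth0.
rewrite mulSn; apply: runs_bind (h ord0) _; rewrite -[_ * _]addn0.
apply: runs_bind (IH _ (fun i => g (lift ord0 i)) _) (runs_ret _ _) => i; exact: h.
Qed.

Lemma runs_matrixM n (f : 'I_n -> 'I_n -> prog K K) (g : 'I_n -> 'I_n -> K) T :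
  (forall i j, runs (f i j) (g i j) T) ->
  runs (matrixM f) (\matrix_(i, j) g i j)%R (n * (n * T)).
Proof.
move=> h; rewrite -[_ * _]addn0.
apply: (runs_bind (a := [tuple [tuple g i j | j < n] | i < n])).
  by apply: runs_tupleM => i; apply: runs_tupleM.
have -> : (\matrix_(i, j) g i j = \matrix_(i, j) tnth (tnth [tuple [tuple g i j | j < n] | i < n] i) j)%R.
  by apply/matrixP => i j; rewrite !mxE !tnth_mktuple.
exact: runs_ret.
Qed.

Lemma runs_copy_mx n (M : 'M[K]_n) : runs (copy_mx M) M (n * n).
Proof.
have {2}-> : M = (\matrix_(i, j) M i j)%R by apply/matrixP => i j; rewrite mxE.
by rewrite -[X in n * X]muln1; apply: runs_matrixM => i j; apply: runs_do.
Qed.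

Lemma runs_zero_mx n : runs (zero_mx K n) 0%R (n * n).
Proof.
have -> : (0 = \matrix_(i, j) 0 :> 'M[K]_n)%R by apply/matrixP => i j; rewrite !mxE.
by rewrite -[X in n * X]muln1; apply: runs_matrixM => i j; apply: runs_do.
Qed.

Section Series.
Variable n : nat.
Implicit Types (M : series K n).

Lemma runs_truncate L M : runs (truncate L M) (take L M) (L * (n * n)).
Proof.
have := runs_mapM (f := @copy_mx K n) (g := id) (take L M) (@runs_copy_mx n).
rewrite map_id => h; apply: runs_le h _.
by rewrite leq_mul2r size_take_min geq_minl orbT.
Qed.

Definition sandwich (S T : 'M[K]_n) M : series K n := [seq S *m X *m T | X <- M]%R.

Lemma runs_mul_lr mm Tm (S T : 'M[K]_n) M :
  (forall X Y : 'M[K]_n, runs (multiply mm X Y) (X *m Y)%R Tm) ->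
  runs (mul_lr mm S T M) (sandwich S T M) (size M * (Tm + Tm)).
Proof. by move=> h; apply: runs_mapM => X; apply: runs_bind. Qed.

Definition shifted r s M : series K n :=
  [seq (\matrix_(i, j) (if (l + (i < r) < (j < n - s))%N then 0
          else nth (const_mx 0) M (l + (i < r) - (j < n - s)) i j)%R)%R
  | l <- iota 0 (size M).+1].

Lemma runs_shift r s M : runs (shift r s M) (shifted r s M) ((size M).+1 * (n * n)).+1.
Proof.
apply: runs_bind_do; have := @runs_mapM; rewrite -{2}(size_iota 0 (size M).+1); apply => l.
by rewrite -[X in n * X]muln1; apply: runs_matrixM => i j; apply: runs_do.
Qed.

Definition squared M : series K n := flatten [seq [:: X; 0%R] | X <- M].

Lemma runs_square_var M : runs (square_var M) (squared M) (size M * (n * n + n * n)).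
Proof.
rewrite -[_ * _]addn0; apply: runs_bind; last exact: runs_ret.
apply: runs_mapM => X; apply: runs_bind; first exact: runs_copy_mx.
rewrite -[X in runs _ _ X]addn0; apply: runs_bind; first exact: runs_zero_mx.
exact: runs_ret.
Qed.

Lemma runs_div_var M : runs (div_var M) (0%R :: M) (n * n).
Proof.
rewrite -[_ * _]addn0; apply: runs_bind; [exact: runs_zero_mx | exact: runs_ret].
Qed.

Definition ceil_quot (x y : nat) := ((x + y).-1 %/ y)%N.

Lemma runs_ceil_div (x y : nat) : (0 < y)%N ->
  runs (ceil_div K x%:Z%R y%:Z%R) (ceil_quot x y)%:Z%R 3.
Proof.
move=> y0; do 2 apply: runs_bind_do; rewrite /=.
have -> : ((ceil_quot x y)%:Z = ((x%:Z + y%:Z - 1) %/ y%:Z)%Z)%R.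
  have -> : (x%:Z + y%:Z - 1 = (x + y).-1%:Z)%R by move: y0; clear; lia.
  by rewrite divz_nat.
exact: (runs_do (ZDiv _ _)).
Qed.

Lemma runs_rescale (ck q : nat) M : (0 < q)%N ->
  runs (rescale ck%:Z%R (2 * q)%:Z%R M)
    (if ceil_quot ck q == (2 * ceil_quot ck (2 * q))%N then squared M
     else 0%R :: squared M)
    (size M * (n * n + n * n) + n * n + 9).
Proof.
move=> q0.
have q20 : (0 < 2 * q)%N by rewrite muln_gt0.
have E : (instr_sem (ZDiv (2 * q)%:Z 2) : int)%R = q%:Z%R :> int.
  by rewrite /= -[2%R]/(2%N%:Z)%R divz_nat mulKn.
eapply runs_le.
  apply: runs_bind_do; rewrite E.
  apply: runs_bind; first exact: runs_ceil_div.
  apply: runs_bind; first exact: runs_ceil_div.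
  do 2 apply: runs_bind_do.
  apply: runs_bind; first exact: runs_square_var.
  rewrite /= -[2%R]/(2%N%:Z)%R -PoszM eqz_nat; case: eqP => _.
    exact: (runs_ret _ (n * n)).
  exact: runs_div_var.
by clear; lia.
Qed.

End Series.
End Running.

(** * A lower bound on the cost of a matrix product *)

Section CostInversion.
Variable K : fieldType.

(** Inversion of [exec] as a function of the program, which settles the type index of [prog]; [True]
    stands where no information is extracted. *)
Definition exec_spec (A : Type) (p : prog K A) : A -> nat -> Prop :=
  match p in prog _ A0 return A0 -> nat -> Prop with
  | Do _ _ => fun _ t => t = 1%N
  | Bind A0 B0 p0 f => fun b t =>
      exists a u v, [/\ exec p0 a u, exec (f a) b v & t = (u + v)%N]
  | _ => fun _ _ => True
  end.

Lemma exec_inv (A : Type) (p : prog K A) a t : exec p a t -> exec_spec p a t.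
Proof. by case=> // A0 B0 p0 f a0 b0 t0 u0 e1 e2; exists a0, t0, u0. Qed.

Lemma mapM_cost (X A : Type) (f : X -> instr K A) (s : seq X) r t :
  exec (mapM (fun x => Do (f x)) s) r t -> (size s <= t)%N.
Proof.
elim: s r t => [//|x s IH] r t H.
have [/= a [u [v [eu ev ->]]]] := exec_inv H.
have /= -> := exec_inv eu.
have [/= b [w [z [/IH le _ ->]]]] := exec_inv ev.
by rewrite add1n ltnS (leq_trans le) // leq_addr.
Qed.

(** Loading both operands into the circuit memory already takes 2 n^2 moves. Hence copying a matrix
    costs no more than a product, whatever omega is. *)
Lemma multiply_cost n (mm : circuit K n) (X Y Z : 'M[K]_n) t :
  exec (multiply mm X Y) Z t -> (2 * (n * n) <= t)%N.
Proof.
move=> H; have [/= z [u [v [_ ev ->]]]] := exec_inv H.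
have [/= inp [u' [v' [/mapM_cost le _ ->]]]] := exec_inv ev.
move: le; rewrite size_cat !size_allpairs -!cardE !card_ord; clear; lia.
Qed.

End CostInversion.

(** * Precision of truncated series *)

Section Agreement.
Variables (K : fieldType) (n : nat).
Implicit Types (M : series K n) (N : 'M[{poly K}]_n).

(* The list M represents the expansion N up to the power e of 1/t, excluded.   *)
Definition agree e M N := forall l i j, (l < e)%N ->
  (nth (const_mx 0) M l) i j = (N i j)`_l.

Lemma agree_le e f M N : (f <= e)%N -> agree e M N -> agree f M N.
Proof. by move=> le h l i j lt; apply: h; apply: leq_trans le. Qed.

Lemma agree_const e (X : 'M[K]_n) : agree e [:: X] (mxC X).
Proof.
move=> l i j _; rewrite mxE coefC; case: l => [//|l] /=.
by rewrite nth_nil mxE.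
Qed.

Lemma agree_at0 e M N : (0 < e)%N -> agree e M N -> nth (const_mx 0) M 0 = mx_at0 N.
Proof.
by move=> e0 h; apply/matrixP => i j; rewrite h // mxE /horner_eval horner_coef0.
Qed.

Lemma agree_truncate e L M N : agree e M N -> agree (minn e L) (take L M) N.
Proof. by move=> h l i j; rewrite leq_min => /andP[le lL]; rewrite nth_take // h. Qed.

Lemma agree_sandwich e (S T : 'M[K]_n) M N : agree e M N ->
  agree e (sandwich S T M) (mxC S *m N *m mxC T).
Proof.
move=> h l i j le.
have -> : nth (const_mx 0) (sandwich S T M) l = S *m nth (const_mx 0) M l *m T.
  have [lt|ge] := ltnP l (size M); first by rewrite (nth_map (const_mx 0)).
  by rewrite !nth_default ?size_map // -/(0 : 'M[K]_n) mulmx0 mul0mx.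
rewrite !mxE coef_sum; apply: eq_bigr => x _.
rewrite !mxE coefMC; congr (_ * _).
rewrite coef_sum; apply: eq_bigr => y _.
by rewrite !mxE coefCM h.
Qed.

(** The division by u consumes one order: coefficient l of the result may need coefficient l + 1 of
    N. *)
Lemma agree_shifted e r s M N : agree e M N ->
  agree e.-1 (shifted r s M)
    (\matrix_(i, j) drop_poly 1 ('X^((r <= i) + (j < n - s))%N * N i j)).
Proof.
move=> h l i j le.
rewrite mxE coef_drop_poly coefXnM.
pose g l : 'M[K]_n := \matrix_(i, j) (if (l + (i < r) < (j < n - s))%N then 0
          else nth (const_mx 0) M (l + (i < r) - (j < n - s)) i j).
have -> : nth (const_mx 0) (shifted r s M) l = g l.
  have [lt|ge] := ltnP l (size M).+1.
    by rewrite (nth_map 0%N) ?size_iota // nth_iota // add0n.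
  rewrite nth_default ?size_map ?size_iota //; apply/matrixP => x y; rewrite !mxE.
  case: ifP => // _; rewrite nth_default ?mxE //.
  by move: (size M) ge => z; case: (y < _)%N; case: (x < r)%N => /=; clear; lia.
rewrite mxE; have -> : (r <= i)%N = ~~ (i < r)%N by rewrite -leqNgt.
set x := (i < r)%N; set y := (j < n - s)%N.
have -> : (l + x < y)%N = (l + 1 < ~~ x + y)%N by case: x; case: y; clear; lia.
have -> : (l + x - y = l + 1 - (~~ x + y))%N by case: x; case: y; clear; lia.
case: ifP => // _; rewrite h //.
by move: le; case: x; case: y; clear; lia.
Qed.

Lemma nth_squared M l :
  nth (const_mx 0) (squared M) l =
  if odd l then const_mx 0 else nth (const_mx 0) M l./2.
Proof.
elim: M l => [|X M IH] [|[|l]] //=; first by rewrite if_same.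
by rewrite negbK -IH.
Qed.

Lemma agree_squared e M N : agree e M N -> agree (2 * e) (squared M) (comp_sqr N).
Proof.
move=> h l i j le; rewrite nth_squared mxE /= coef_comp_poly_Xn // dvdn2 divn2.
by case: (odd l) => /=; [rewrite mxE | rewrite h // ltn_half_double -mul2n].
Qed.

Lemma agree_cons0 e M N : agree e M N -> agree e.+1 (0 :: M) ('X *: N).
Proof.
move=> h [|l] i j le /=; first by rewrite !mxE coefXM.
by rewrite mxE coefXM /= h.
Qed.

End Agreement.

(** * Effect and cost of one iteration *)

Section Iteration.
Variables (K : fieldType) (n m : nat) (mm : circuit K n) (solver : R_solver K).
Variables (g Tm : nat).
Hypothesis runs_multiply : forall X Y : 'M[K]_n, runs (multiply mm X Y) (X *m Y) Tm.
Implicit Types (Bt : m.-tuple (series K n)).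

Definition trunc_len := (2 * n ^ 2 * m)%N.
Local Notation L := trunc_len.

(** One bound for every exit of [iteration]: the costs of shifting and of rescaling are added,
    although at most one of them is incurred. *)
Definition iter_cost := (g + 30 + m * (L * (n * n)) +
  m * (L * (Tm + Tm) + (L.+1 * (n * n)).+1) +
  m * (L * (n * n + n * n) + n * n + 9))%N.

Definition truncated Bt := [tuple take L (tnth Bt k) | k < m].

Definition leading Bt k := nth (const_mx (0 : K)) (tnth Bt k) 0.

Definition shift_step S T r s Bt : m.-tuple (series K n) :=
  [tuple shifted r s (sandwich S T (tnth (truncated Bt) k)) | k < m].

Definition rescale_step (c : 'I_m -> nat) q Bt : m.-tuple (series K n) :=
  [tuple if ceil_quot (c k) q == (2 * ceil_quot (c k) (2 * q))%N
         then squared (tnth (truncated Bt) k)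
         else 0 :: squared (tnth (truncated Bt) k) | k < m].

Lemma runs_truncated Bt :
  runs (tupleM (fun k => truncate (2 * n ^ 2 * m) (tnth Bt k))) (truncated Bt) (m * (L * (n * n))).
Proof. by apply: runs_tupleM => k; apply: runs_truncate. Qed.

Lemma size_truncated Bt k : (size (tnth (truncated Bt) k) <= L)%N.
Proof. by rewrite tnth_mktuple size_take_min geq_minl. Qed.

Lemma runs_iteration_shift (c : 'I_m -> int) N th q D Bt S T r s :
  runs (solver (leading Bt)) (RAnswer S T r s) g ->
  ~~ (n%:Z <= 2 * n%:Z - r%:Z - s%:Z) ->
  runs (iteration mm solver c N (State th q D Bt))
    (inl (State th q (D + n%:Z - r%:Z - s%:Z) (shift_step S T r s Bt))) iter_cost.
Proof.
move=> hs hv.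
have hk k : runs (M <- mul_lr mm S T (tnth (truncated Bt) k) ;; shift r s M)%prog
    (shifted r s (sandwich S T (tnth (truncated Bt) k)))
    (L * (Tm + Tm) + (L.+1 * (n * n)).+1).
  have le := size_truncated Bt k.
  apply: runs_bind; first by apply: runs_le; [exact: runs_mul_lr|rewrite leq_mul2r le orbT].
  apply: runs_le; first exact: runs_shift.
  by rewrite ltnS leq_mul2r ltnS size_map le orbT.
eapply runs_le.
  apply: runs_bind_do; apply: runs_bind; first exact: hs.
  apply: runs_bind; first exact: runs_truncated.
  do 4 apply: runs_bind_do; rewrite /= hv.
  apply: runs_bind; first by apply: runs_tupleM => k; apply: hk.
  do 3 apply: runs_bind_do; rewrite /=; exact: (runs_ret _ _ 0).
rewrite /iter_cost; clear; lia.
Qed.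

Lemma runs_iteration_stop (c : 'I_m -> int) N q D Bt S T r s :
  runs (solver (leading Bt)) (RAnswer S T r s) g ->
  n%:Z <= 2 * n%:Z - r%:Z - s%:Z ->
  runs (iteration mm solver c N (State N q D Bt)) (inr D) iter_cost.
Proof.
move=> hs hv; eapply runs_le.
  apply: runs_bind_do; apply: runs_bind; first exact: hs.
  apply: runs_bind; first exact: runs_truncated.
  do 4 apply: runs_bind_do; rewrite /= hv.
  apply: runs_bind_do; rewrite /= eqxx; rewrite /=; exact: (runs_ret _ _ 0).
rewrite /iter_cost; clear; lia.
Qed.

Lemma runs_iteration_rescale (c : 'I_m -> nat) N th q D Bt S T r s :
  runs (solver (leading Bt)) (RAnswer S T r s) g ->
  n%:Z <= 2 * n%:Z - r%:Z - s%:Z -> th != N -> (0 < q)%N ->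
  runs (iteration mm solver (fun k => (c k)%:Z) N (State th (2 * q)%:Z D Bt))
    (inl (State (th + 1) q%:Z (2 * D) (rescale_step c q Bt))) iter_cost.
Proof.
move=> hs hv nth q0.
have hk k : runs (rescale (c k)%:Z (2 * q)%:Z (tnth (truncated Bt) k))
    (if ceil_quot (c k) q == (2 * ceil_quot (c k) (2 * q))%N
     then squared (tnth (truncated Bt) k) else 0 :: squared (tnth (truncated Bt) k))
    (L * (n * n + n * n) + n * n + 9).
  apply: runs_le; first exact: runs_rescale.
  by rewrite !leq_add2r leq_mul2r size_truncated orbT.
eapply runs_le.
  apply: runs_bind_do; apply: runs_bind; first exact: hs.
  apply: runs_bind; first exact: runs_truncated.
  do 4 apply: runs_bind_do; rewrite /= hv.
  apply: runs_bind_do; rewrite /= (negbTE nth).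
  apply: runs_bind; first by apply: runs_tupleM => k; apply: hk.
  do 3 apply: runs_bind_do.
  have -> : (instr_sem (ZDiv (2 * q)%:Z 2) : int) = q%:Z :> int.
    by rewrite /= -[2]/(2%N%:Z) divz_nat mulKn.
  rewrite /=; exact: (runs_ret _ _ 0).
rewrite /iter_cost; clear; lia.
Qed.
End Iteration.

(** Ceiling division is left adjoint to multiplication by y; the inequalities between scaled costs
    are derived from this. *)
Lemma ceil_quot_le x y z : (0 < y)%N -> (ceil_quot x y <= z)%N = (x <= z * y)%N.
Proof.
move=> y0; rewrite /ceil_quot -ltnS ltn_divLR // mulSn.
by move: (z * y)%N y0; clear; lia.
Qed.

(** * Scaling phases and the loop invariant *)

Section MainLoop.
Variables (R : realType) (K : fieldType) (n m : nat) (mm : circuit K n).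
Variables (solver : R_solver K) (gamma : nat -> nat -> nat) (Tm : nat).
Hypothesis runs_multiply : forall X Y : 'M[K]_n, runs (multiply mm X Y) (X *m Y) Tm.
Hypothesis solverP : solves_R_within solver gamma.
Variables (A : 'I_m -> 'M[K]_n) (c : 'I_m -> nat) (N : nat).
Hypotheses (n_gt0 : (0 < n)%N) (m_gt0 : (0 < m)%N).

(** Here h = N - theta counts the scaling phases still to come. *)
Definition cost_at h k := ceil_quot (c k) (2 ^ h).

Lemma cost_at0 : cost_at 0 = c.
Proof. by apply/funext => k; rewrite /cost_at /ceil_quot expn0 addn1 divn1. Qed.

(** The left inequality feeds [certificate_sqr], the right one [scaled_lower_bound]; together they
    leave only 0 and 1 for the exponent in [scale_sqr]. *)
Lemma cost_at_double h k : (cost_at h k <= 2 * cost_at h.+1 k <= (cost_at h k).+1)%N.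
Proof.
rewrite /cost_at expnS; have q0 : (0 < 2 ^ h)%N by rewrite expn_gt0.
have q20 : (0 < 2 * 2 ^ h)%N by rewrite muln_gt0.
move: (2 ^ h)%N q0 q20 => q q0 q20; apply/andP; split.
  by rewrite ceil_quot_le // mulnAC mulnC -ceil_quot_le // mulnC.
have : (ceil_quot (c k) (2 * q) <= uphalf (ceil_quot (c k) q))%N.
  rewrite ceil_quot_le // mulnA -ceil_quot_le // muln2 uphalf_half.
  by rewrite -{1}(odd_double_half (ceil_quot (c k) q)) doubleD leq_add2r; case: (odd _).
move: (ceil_quot (c k) (2 * q)) (ceil_quot (c k) q) => x y; clear; lia.
Qed.

Lemma R_optimal_full (B : 'I_m -> 'M[K]_n) S T r s :
  R_optimal B (RAnswer S T r s) -> n%:Z <= 2 * n%:Z - r%:Z - s%:Z -> nc_full B.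
Proof.
case=> _ [ler les] _ opt hv S' T' I J uS uT hz; have := opt S' T' I J uS uT hz.
have := max_card (mem I); have := max_card (mem J); rewrite !card_ord.
by move: ler les hv; move: #|I| #|J|; clear; lia.
Qed.

Lemma trunc_len_ge : (2 * n <= trunc_len n m)%N.
Proof.
rewrite /trunc_len -mulnA leq_mul2l /= -mulnn -mulnA leq_pmulr //.
by rewrite muln_gt0 n_gt0.
Qed.

(* LB bounds every objective of the current phase from below, so D - LB     *)
(* limits the shift steps left in the phase; prec says that the truncated series *)
(* stay exact at order 0 through these steps and at least to order n at the    *)
(* end of the phase.  A rescaling makes the gap at most n again.               *)
Lemma runs_loop mu : forall h (D LB : int) e (Bt : m.-tuple (series K n)) P Q a B,
  (h <= N)%N -> certificate A (cost_at h) P Q a B -> D = objective P Q a ->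
  (forall k, agree e (tnth Bt k) (B k)) ->
  (forall P Q a, pfeasible A (cost_at h) P Q a -> LB <= objective P Q a) ->
  D - LB <= n%:Z -> D - LB + n%:Z <= e%:Z -> (`|D - LB| + h * n.+1 < mu)%N ->
  exists2 d : int,
    runs (Loop (iteration mm solver (fun k => (c k)%:Z) N%:Z)
      (State (N - h)%:Z (2 ^ h)%:Z D Bt)) d (mu * iter_cost n m (gamma n m) Tm) &
    degDet R A c = (d%:~R)%:E.
Proof.
elim: mu => [//|mu IH] h D LB e Bt P Q a B hN cert ED agr lb gap prec meas.
have lbD : LB <= D by rewrite ED; apply: lb (certificate_feasible cert).
have lenL := trunc_len_ge.
have e0 : (0 < e)%N by move: n_gt0 prec lbD; clear; lia.
have leadE : leading Bt = fun k => mx_at0 (B k).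
  by apply/funext => k; apply: agree_at0 (agr k).
have [[S T r s] [t [et opt le_t]]] := solverP (leading Bt).
have hs : runs (solver (leading Bt)) (RAnswer S T r s) (gamma n m) by exists t.
rewrite {}leadE in opt.
have agrT k : agree (minn e (trunc_len n m)) (tnth (truncated Bt) k) (B k).
  by rewrite tnth_mktuple; apply: agree_truncate.
have [hv|hv] := boolP (n%:Z <= 2 * n%:Z - r%:Z - s%:Z).
- have full := R_optimal_full opt hv.
  case: h => [|h] in hN cert lb meas *.
    exists D.
      apply: runs_le; last exact: leq_pmull.
      by apply: runs_stop; rewrite subn0; apply: runs_iteration_stop hs hv.
    rewrite cost_at0 in cert; apply/eqP; rewrite eq_le; apply/andP; split.
      by rewrite ED; apply: degDet_le (certificate_feasible cert).
    apply: degDet_ge => P' Q' a' f; rewrite ED; exact: certificate_optimal cert full f.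
  have cc k := cost_at_double h k.
  have [cert' ED'] := certificate_sqr (fun k => proj1 (andP (cc k))) cert.
  suff [d hd Ed] : exists2 d : int,
      runs (Loop (iteration mm solver (fun k => (c k)%:Z) N%:Z)
        (State (N - h)%:Z (2 ^ h)%:Z (2 * D) (rescale_step c (2 ^ h) Bt))) d
        (mu * iter_cost n m (gamma n m) Tm) & degDet R A c = (d%:~R)%:E.
    exists d => //; rewrite mulSn; apply: runs_next hd.
    have -> : (N - h)%:Z = (N - h.+1)%:Z + 1 by move: hN; clear; lia.
    rewrite expnS; apply: runs_iteration_rescale hs hv _ _; last by rewrite expn_gt0.
    by move: hN; clear; lia.
  (* The current pair is optimal, so 2 D - n bounds the next phase from below and the gap restarts
     at n. Both e >= n and the truncation length >= 2 n hold, so the doubled precision is at least 2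
     n. The measure loses n + 1 with the phase and regains at most n. *)
  apply: (IH h (2 * D) (2 * D - n%:Z) (2 * minn e (trunc_len n m))%N _ _ _ _ _ (ltnW hN) cert').
  + by rewrite ED' ED.
  + move=> k; rewrite tnth_mktuple /scale_sqr; have := cc k; rewrite /cost_at expnS.
    case: eqP => [-> _|nE /andP[le1 le2]].
      by rewrite subnn expr0 scale1r; apply: agree_squared.
    have -> : (2 * ceil_quot (c k) (2 * 2 ^ h) - ceil_quot (c k) (2 ^ h) = 1)%N.
      move: le1 le2 nE; move: (ceil_quot _ _) (ceil_quot _ _); clear; lia.
    by apply: agree_le (agree_cons0 (agree_squared (agrT k))).
  + move=> P' Q' a' f; rewrite ED.
    apply: scaled_lower_bound n_gt0 cert full _ f => k.
    by have /andP[] := cc k.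
  + by move: (n%:Z); clear; lia.
  + by move: prec lbD lenL; clear; lia.
  + by move: meas; rewrite mulSn; move: (h * _)%N; clear; lia.
case: opt => [[uS uT] [ler les] hz _].
have [cert' ED'] := certificate_shift cert uS uT ler les hz.
rewrite -ED in ED'.
have lb' := lb _ _ _ (certificate_feasible cert'); rewrite ED' in lb'.
suff [d hd Ed] : exists2 d : int,
    runs (Loop (iteration mm solver (fun k => (c k)%:Z) N%:Z)
      (State (N - h)%:Z (2 ^ h)%:Z (D + n%:Z - r%:Z - s%:Z) (shift_step S T r s Bt))) d
      (mu * iter_cost n m (gamma n m) Tm) & degDet R A c = (d%:~R)%:E.
  exists d => //; rewrite mulSn; apply: runs_next hd.
  exact: runs_iteration_shift hs hv.
(* The objective falls by r + s - n >= 1, which pays for the order lost in the division by u. As the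
   gap is at most n, a truncation length of 2 n or more leaves the required precision intact. *)
apply: (IH h _ LB (minn e (trunc_len n m)).-1 _ _ _ _ _ hN cert' _ _ lb).
- by rewrite ED'.
- by move=> k; rewrite tnth_mktuple; apply/agree_shifted/agree_sandwich/agrT.
- by move: gap lb' hv; clear; lia.
- by move: prec gap lbD lb' hv lenL; clear; lia.
by move: meas gap lb' hv; move: (h * _)%N; clear; lia.
Qed.
End MainLoop.

(** * Computing C, N and 2^N *)

Section Initialization.
Variables (K : fieldType) (m : nat) (c : 'I_m -> nat).

Lemma runs_max_cost :
  runs (max_cost K (fun k => (c k)%:Z)) (\max_(k < m) c k)%:Z m.
Proof.
have fold_max s C0 : runs (K := K) (foldM (fun k C => (b <- Do (ZLe C (c k)%:Z) ;;
    Ret (if b then (c k)%:Z else C))%prog) s C0%:Z)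
    (maxn C0 (\max_(k <- s) c k))%:Z (size s).
  elim: s C0 => [|k s IH] C0 /=; first by rewrite big_nil maxn0; apply: runs_ret.
  rewrite big_cons maxnA -add1n.
  apply: (runs_bind (a := (maxn C0 (c k))%:Z)); last exact: IH.
  apply: runs_bind_do; have -> : (maxn C0 (c k))%:Z =
      if instr_sem (ZLe C0%:Z (c k)%:Z : instr K bool) then (c k)%:Z else C0%:Z.
    by rewrite /= lez_nat /maxn; case: ltngtP => // ->.
  exact: (runs_ret _ _ 0).
have := fold_max (enum 'I_m) 0%N; rewrite max0n -cardE card_ord.
by rewrite (big_enum _ _ xpredT).
Qed.

Lemma runs_ceil_log2 (C : nat) :
  runs (ceil_log2 K C%:Z) ((up_log 2 C)%:Z, (2 ^ up_log 2 C)%:Z) (3 * up_log 2 C + 1).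
Proof.
set N := up_log 2 C.
suff H d i : (i + d = N)%N ->
    runs (K := K) (Loop (fun x : int * int =>
          (b <- Do (ZLe C%:Z x.2) ;;
           if b then Ret (inr x)
           else (N <- Do (ZAdd x.1 1) ;; q <- Do (ZMul 2 x.2) ;;
                 Ret (inl (N, q))))%prog) (i%:Z, (2 ^ i)%:Z))
      (N%:Z, (2 ^ N)%:Z) (3 * d + 1).
  exact: (H N 0%N).
elim: d i => [|d IH] i Ei.
  rewrite addn0 in Ei; rewrite Ei; apply: runs_stop; apply: runs_bind_do.
  by rewrite /= lez_nat up_logP //; apply: (runs_ret _ _ 0).
have -> : (3 * d.+1 + 1 = 3 + (3 * d + 1))%N by clear; lia.
apply: (runs_next (s' := (i.+1%:Z, (2 ^ i.+1)%:Z))); last by apply: IH; rewrite addSnnS.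
apply: runs_bind_do; rewrite /= lez_nat.
have -> : (C <= 2 ^ i)%N = false.
  apply/negP => le; have := up_log_min (isT : 1 < 2)%N le.
  by rewrite -/N -Ei; clear; lia.
do 2 apply: runs_bind_do; rewrite /=.
have -> : i.+1%:Z = i%:Z + 1 by clear; lia.
have -> : (2 ^ i.+1)%:Z = 2 * (2 ^ i)%:Z by rewrite expnS PoszM.
exact: (runs_ret _ _ 0).
Qed.

End Initialization.

(** * The whole algorithm from its starting pair *)

Section Correctness.
Variables (R : realType) (K : fieldType) (n m : nat) (mm : circuit K n).
Variables (solver : R_solver K) (gamma : nat -> nat -> nat) (Tm : nat).
Hypothesis runs_multiply : forall X Y : 'M[K]_n, runs (multiply mm X Y) (X *m Y) Tm.
Hypothesis solverP : solves_R_within solver gamma.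
Variables (A : 'I_m -> 'M[K]_n) (c : 'I_m -> nat).
Hypotheses (n_gt0 : (0 < n)%N) (c_gt0 : forall k, (0 < c k)%N).
Hypothesis finite_degDet : (-oo < degDet R A c)%E.
Local Notation N := (up_log 2 (\max_(k < m) c k)).

(** Without variables the whole n x n block is zero, against [initial_full]. *)
Lemma finite_degDet_m_gt0 : (0 < m)%N.
Proof.
case: m A c finite_degDet => // A0 c0 /initial_full full.
have := full 1%:M 1%:M [set: 'I_n]%SET [set: 'I_n]%SET (unitmx1 _ _) (unitmx1 _ _).
rewrite cardsT card_ord => h; have : (n + n <= n)%N by apply: h => -[].
by move: n_gt0; clear; lia.
Qed.

Lemma runs_deg_det : exists2 d : int,
  runs (deg_det_cost_scaling mm solver A (fun k => (c k)%:Z)) d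
    (m + (3 * N + 1 + (m * (n * n) +
      (N * n.+1).+1 * iter_cost n m (gamma n m) Tm))) &
  degDet R A c = (d%:~R)%:E.
Proof.
have cost1 k : cost_at c N k = 1%N.
  have q0 : (0 < 2 ^ N)%N by rewrite expn_gt0.
  apply/eqP; rewrite eqn_leq ceil_quot_le // mul1n.
  rewrite (leq_trans _ (up_logP _ (isT : 1 < 2)%N)) /=; last exact: leq_bigmax.
  by rewrite ltnNge ceil_quot_le // mul0n -ltnNge c_gt0.
pose B k := mxC (A k).
(* At scale 2^N all costs are 1, so the pair (u I, I) with a = 0 has B = A; its objective n is the
   starting value of the algorithm. *)
have cert : certificate A (cost_at c N) 'X%:M 1%:M 0 B.
  split=> [||k]; first by rewrite det_scalar expf_neq0 // polyX_eq0.
    by rewrite det1 oner_neq0.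
  by rewrite cost1 mulmx1 mul_scalar_mx.
have obj : objective ('X%:M : 'M[{poly K}]_n) 1%:M 0 = n%:Z.
  rewrite /objective det_scalar det1 xvalXn xval_unit ?hornerC ?oner_neq0 //.
  by rewrite muln0 subr0 addr0.
have full : nc_full (fun k => mx_at0 (B k)).
  have -> : (fun k => mx_at0 (B k)) = A by apply/funext => k; rewrite mx_at0C.
  exact: initial_full finite_degDet.
suff [d hd Ed] : exists2 d : int,
    runs (Loop (iteration mm solver (fun k => (c k)%:Z) N%:Z)
      (State (N - N)%:Z (2 ^ N)%:Z n%:Z [tuple [:: A k] | k < m])) d
      ((N * n.+1).+1 * iter_cost n m (gamma n m) Tm) & degDet R A c = (d%:~R)%:E.
  exists d => //.
  apply: runs_bind; first exact: runs_max_cost.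
  apply: runs_bind; first exact: runs_ceil_log2.
  apply: runs_bind.
    apply: runs_tupleM => k; apply: (runs_le (T := (n * n + 0)%N)); last by rewrite addn0.
    by apply: runs_bind; [exact: runs_copy_mx|exact: runs_ret].
  by rewrite subnn in hd; exact: hd.
(* Fullness of A makes the starting pair optimal, so the first gap is 0 and the measure is N (n +
   1). *)
apply: (runs_loop R runs_multiply solverP n_gt0 finite_degDet_m_gt0 (LB := n%:Z) (e := n) (leqnn N) cert (esym obj)).
- by move=> k; rewrite tnth_mktuple; apply: agree_const.
- by move=> P Q a f; rewrite -obj; apply: certificate_optimal cert full f.
- by rewrite subrr.
- by rewrite subrr add0r.
by rewrite subrr.
Qed.
End Correctness.

(** * Arithmetic of the running time bound *)

Lemma up_log2_le (R : realType) (C : nat) :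
  (up_log 2 C).+1%:R <= 3%:R * Num.max 1 (ln C%:R / ln 2%:R) :> R.
Proof.
have max1 : 1 <= Num.max 1 (ln C%:R / ln 2%:R) :> R by rewrite le_max lexx.
have [le1|gt1] := leqP C 1.
  have -> : up_log 2 C = 0%N by apply/eqP; rewrite up_log_eq0 le1.
  by apply: (le_trans max1); rewrite ler_peMl ?ler1n // (le_trans ler01).
have ln2 : 0 < ln 2%:R :> R by rewrite ln_gt0 // ltr1n.
have /andP[lt _] := up_log_bounds (isT : 1 < 2)%N gt1.
have N0 : (0 < up_log 2 C)%N by rewrite up_log_gt0 gt1.
(* From 2^(N - 1) < C comes N - 1 <= log_2 C; the maximum with 1 then pays for the remaining 2. *)
have lt_ln : (up_log 2 C).-1%:R <= ln C%:R / ln 2%:R :> R.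
  rewrite ler_pdivlMr // mulr_natl -lnXn ?ltr0n // -natrX ltW // ltr_ln ?posrE ?ltr0n ?expn_gt0 //.
    by rewrite ltr_nat.
  by rewrite (ltn_trans _ gt1).
have le_max : (up_log 2 C).-1%:R <= Num.max 1 (ln C%:R / ln 2%:R) :> R.
  by rewrite le_max lt_ln orbT.
have -> : (up_log 2 C).+1 = ((up_log 2 C).-1 + 2)%N by rewrite addn2 prednK.
by rewrite natrD; move: max1 le_max; lra.
Qed.

(** Put X = n^2 m^2 Tm. As n^2 <= Tm absorbs the copying, an iteration costs at most g + 96 X. At
    most (N + 1) 2 n iterations occur, and 4 X more for each of these covers the initialization;
    finally 2 n <= 2 n^2 m. *)
Lemma total_cost_le n m g Tm N : (0 < n)%N -> (0 < m)%N -> (n * n <= Tm)%N ->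
  (m + (3 * N + 1 + (m * (n * n) + (N * n.+1).+1 * iter_cost n m g Tm)) <=
   N.+1 * (2 * (n * n * m)) * (g + 100 * (n * n * (m * m) * Tm)))%N.
Proof.
move=> n0 m0 leT.
set a := (n * n)%N in leT *.
have a0 : (0 < a)%N by rewrite muln_gt0 n0.
pose p := (a * (m * m))%N; set X := (a * (m * m) * Tm)%N.
have p0 : (0 < p)%N by rewrite /p muln_gt0 a0 muln_gt0 m0.
have T0 : (0 < Tm)%N by apply: leq_trans leT.
have lemp : (m <= p)%N by rewrite /p mulnA leq_pmull // muln_gt0 a0.
have paX : (p * a <= X)%N by rewrite leq_mul.
have maX : (m * a <= X)%N by rewrite leq_mul.
have mX : (m <= X)%N by rewrite (leq_trans lemp) // leq_pmulr.
have X0 : (0 < X)%N by apply: leq_trans mX.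
have it : (iter_cost n m g Tm <= g + 96 * X)%N.
  rewrite /iter_cost /trunc_len -mulnn -/a.
  have -> : (m * (2 * a * m * a) = 2 * (p * a))%N by rewrite /p; clear; lia.
  have -> : (m * (2 * a * m * (Tm + Tm) + ((2 * a * m).+1 * a).+1) =
      4 * X + 2 * (p * a) + m * a + m)%N by rewrite /X /p; clear; lia.
  have -> : (m * (2 * a * m * (a + a) + a + 9) = 4 * (p * a) + m * a + 9 * m)%N.
    by rewrite /p; clear; lia.
  by move: (p * a)%N (m * a)%N paX maX mX X0; clearbody X; clear; lia.
have init : (m + 3 * N + 1 + m * a <= N.+1 * (2 * n) * (4 * X))%N.
  apply: (leq_trans (n := (N.+1 * (4 * X))%N)); last first.
    by rewrite leq_mul2r leq_pmulr ?orbT // muln_gt0.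
  have : (N <= N * X)%N by rewrite leq_pmulr.
  by rewrite [(N.+1 * _)%N]mulSn [(N * (4 * X))%N]mulnCA; move: (N * X)%N (m * a)%N maX mX X0; clearbody X; clear; lia.
have rounds : ((N * n.+1).+1 <= N.+1 * (2 * n))%N by move: n0; clear; nia.
have -> : (m + (3 * N + 1 + (m * a + (N * n.+1).+1 * iter_cost n m g Tm)) =
  m + 3 * N + 1 + m * a + (N * n.+1).+1 * iter_cost n m g Tm)%N by rewrite !addnA.
apply: leq_trans (leq_add init (leq_mul rounds it)) _.
rewrite -mulnDr leq_mul //; last by clear; lia.
by rewrite leq_mul2l leq_mul2l /= /a -mulnA leq_pmulr ?orbT // muln_gt0 n0.
Qed.

Theorem theorem3p4 (R : realType) (K : fieldType)
    (mm : forall n : nat, circuit K n) (omega : R)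
    (mm_omega : mm_exponent mm omega) :
  exists kappa : R,
    forall (gamma : nat -> nat -> nat) (solver : R_solver K),
    solves_R_within solver gamma ->
    forall (n m : nat) (A : 'I_m -> 'M[K]_n) (c : 'I_m -> nat),
    (0 < n)%N ->
    (forall k : 'I_m, (0 < c k)%N) ->
    (-oo < degDet R A c)%E ->
    let C := (\max_(k < m) c k)%N in
    exists (d : int) (t : nat),
      [/\ exec (deg_det_cost_scaling (mm n) solver A (fun k => (c k)%:Z)) d t,
          degDet R A c = (d%:~R)%:E &
          t%:R <= kappa *
            (((gamma n m)%:R + n%:R `^ (2%:R + omega) * m%:R ^+ 2)
             * n%:R ^+ 2 * m%:R * Num.max 1 (ln C%:R / ln 2%:R))].
Proof.
have [kappa0 mmP] := mm_omega.
(* The 6 is the 3 of [up_log2_le] times the 2 of [total_cost_le]; 600 also includes the factor 100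
   there, and [kappa0] is the constant of matrix multiplication. *)
exists (6%:R + 600%:R * kappa0) => gamma solver solverP n m A c n0 c0 fin C.
have m0 := finite_degDet_m_gt0 n0 fin.
have [t0 ex0 le0] := mmP n n0 0 0.
pose W : R := n%:R `^ omega.
have cost0 := multiply_cost ex0.
have kW : 0 <= kappa0 * W by apply: le_trans le0; rewrite ler0n.
(* Times are integers, so rounding the real bound down keeps it valid. *)
pose Tm := Num.truncn (kappa0 * W).
have runs_mul (X Y : 'M[K]_n) : runs (multiply (mm n) X Y) (X *m Y) Tm.
  by have [t et le] := mmP n n0 X Y; exists t; rewrite // truncn_ge_nat.
have leT : (n * n <= Tm)%N.
  rewrite truncn_ge_nat // (le_trans _ le0) // ler_nat (leq_trans _ cost0) //.
  by rewrite leq_pmull.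
have TmW : Tm%:R <= kappa0 * W by rewrite truncn_le.
have W0 : 0 <= W by rewrite powR_ge0.
have k0 : 0 <= kappa0.
  have W1 : 0 < W by rewrite powR_gt0 // ltr0n.
  by rewrite -(pmulr_lge0 _ W1).
have [d [t et le] Ed] := runs_deg_det runs_mul solverP n0 c0 fin.
exists d, t; split=> //.
have := leq_trans le (total_cost_le (gamma n m) _ n0 m0 leT).
rewrite -(ler_nat R) => /le_trans; apply.
have := up_log2_le R C; set N := up_log 2 _; set M := Num.max _ _ => leN.
rewrite powRD; last by rewrite pnatr_eq0 -lt0n n0 implybT.
rewrite powR_mulrn ?ler0n // -/W.
have M0 : 0 <= M by rewrite le_max ler01.
pose Z : R := n%:R ^+ 2 * W * m%:R ^+ 2; pose Q : R := n%:R ^+ 2 * m%:R.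
have Z0 : 0 <= Z by rewrite !mulr_ge0 ?exprn_ge0.
have Q0 : 0 <= Q by rewrite mulr_ge0 ?exprn_ge0.
have g0 : 0 <= (gamma n m)%:R :> R by [].
rewrite natrM; apply: (@le_trans _ _ ((3%:R * M * (2%:R * Q)) * ((gamma n m)%:R + 100%:R * (kappa0 * Z)))).
  rewrite ler_pM //.
    by rewrite natrM ler_pM // /Q expr2 !natrM.
  rewrite natrD lerD2l natrM ler_pM2l ?ltr0n // !natrM -!expr2 /Z.
  have -> : kappa0 * (n%:R ^+ 2 * W * m%:R ^+ 2) = n%:R ^+ 2 * m%:R ^+ 2 * (kappa0 * W) by ring.
  by rewrite ler_wpM2l // mulr_ge0 ?exprn_ge0.
rewrite -subr_ge0.
have -> : (6%:R + 600%:R * kappa0) * (((gamma n m)%:R + n%:R ^+ 2 * W * m%:R ^+ 2) *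
    n%:R ^+ 2 * m%:R * M) -
    3%:R * M * (2%:R * Q) * ((gamma n m)%:R + 100%:R * (kappa0 * Z)) =
  (600%:R * (kappa0 * (gamma n m)%:R) + 6%:R * Z) * (Q * M) by rewrite /Z /Q; ring.
exact: mulr_ge0 (addr_ge0 (mulr_ge0 (ler0n _ _) (mulr_ge0 k0 g0))
  (mulr_ge0 (ler0n _ _) Z0)) (mulr_ge0 Q0 M0).
Qed.
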